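(* Assume the Exponential Time Hypothesis (ETH). There is a 5-layer, $O(n^2)$-width ReLU network $G_5$ and an observation $x$ such that the computational complexity to determine whether there exists a $z\in\mathbb{R}^n$ with $\|G_5(z)-x\|_p\le\delta$ is $2^{\Omega(n)}$ for a given $\delta>0$ and any positive even number $p$.
   Context: ReLU acts coordinatewise by $\mathrm{ReLU}(t)=\max\{t,0\}$. An $L$-layer ReLU network $G=G_L:\mathbb{R}^n\to\mathbb{R}^{m_L}$ is given by weight matrices $W_1\in\mathbb{R}^{m_1\times n}$, $W_l\in\mathbb{R}^{m_l\times m_{l-1}}$ ($2\le l\le L$) and biases $b_l\in\mathbb{R}^{m_l}$, via $G_1(z)=\mathrm{ReLU}(W_1z+b_1)$ and $G_l(z)=\mathrm{ReLU}(W_lG_{l-1}(z)+b_l)$ for $l=2,\dots,L$. Its width is $\max_l m_l$, and $n$ is the dimension of the latent vector $z$. $\|\cdot\|_p$ is the $\ell_p$-norm. The problem considered is approximate inversion as a decision problem: a ReLU network, an observation $x$ and a parameter $\delta>0$ are given, and one must decide whether such a $z$ exists. 3-SAT: given a SAT formula on $n$ variables with each clause of size 3, decide whether it is satisfiable. ETH: there exists $\gamma>0$ such that 3-SAT cannot be solved in time $2^{\gamma n}$. *)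

(* Defs.v *)
(* MathComp / MathComp-Analysis. *)
From HB Require Import structures.
From mathcomp Require Import all_boot all_order all_algebra.
From mathcomp Require Import reals exp.

Set Implicit Arguments.
Unset Strict Implicit.
Unset Printing Implicit Defensive.

Import Order.TTheory GRing.Theory Num.Theory.

Local Open Scope ring_scope.

(* Deterministic multi-tape Turing machines with tape alphabet {blank, 0, 1}
   (None is the blank) and tapes that are infinite in both directions. *)

Definition cell := option bool.

Inductive move := MoveLeft | Stay | MoveRight.

(* A tape is (l, r): r lists the cells from the head rightwards, l the cells to
   the left of the head, nearest first; all the cells not listed are blank. *)
Definition tape : Type := seq cell * seq cell.

Definition tape_read (t : tape) : cell := head None t.2.

Definition tape_act (a : cell * move) (t : tape) : tape :=
  let: (l, r) := (t.1, a.1 :: behead t.2) in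
  match a.2 with
  | MoveLeft => (behead l, head None l :: r)
  | Stay => (l, r)
  | MoveRight => (head None r :: l, behead r)
  end.

(* There are ntapes.+1 tapes; tape ord0 is the input tape.  A state q with
   verdict q = Some b is a halting state with answer b. *)
Record machine := Machine {
  ntapes : nat;
  state : finType;
  start : state;
  verdict : state -> option bool;
  trans : state -> ntapes.+1.-tuple cell ->
          state * ntapes.+1.-tuple (cell * move)
}.

Definition config (M : machine) : Type :=
  state M * (ntapes M).+1.-tuple tape.

Definition init_config (M : machine) (w : seq bool) : config M :=
  (start M,
   [tuple (if i == ord0 then ([::], map Some w) else ([::], [::]))
   | i < (ntapes M).+1]).

Definition step (M : machine) (c : config M) : config M :=
  if verdict c.1 is Some _ then c else
  let: (q, acts) := trans c.1 [tuple tape_read (tnth c.2 i) | i < (ntapes M).+1] in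
  (q, [tuple tape_act (tnth acts i) (tnth c.2 i) | i < (ntapes M).+1]).

(* Some b if M, started on the word w, has halted with answer b after at most t
   steps, and None if it is still running. *)
Definition answer (M : machine) (t : nat) (w : seq bool) : option bool :=
  verdict (iter t (@step M) (init_config M w)).1.

(* The time bounds below are functions of param, the number n of variables,
   resp. the dimension n of the latent vector; code x is the input word. *)
Record problem := Problem {
  instance : Type;
  code : instance -> seq bool;
  param : instance -> nat;
  yes : instance -> Prop
}.

(* "Time 2^(c n)" is understood up to a factor polynomial in the length of the
   input, as usual for ETH: for a given n the input is not of bounded length, so
   a bound in n alone would be unachievable for trivial reasons. *)
Definition solvable_in_exp_time (R : realType) (P : problem) (c : R) : Prop :=
  exists (M : machine) (K k : nat), forall x : instance P,
  exists (t : nat) (b : bool),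
    [/\ answer M t (code x) = Some b,
        b <-> yes x
      & t%:R <= K%:R * (size (code x)).+1%:R ^+ k
                * 2 `^ (c * (param x)%:R)].

(* Complexity 2^(Omega(n)). *)
Definition exp_hard (R : realType) (P : problem) : Prop :=
  exists2 c : R, 0 < c & ~ solvable_in_exp_time P c.

(* Numbers of variables, indices and dimensions are written in unary, the
   numerators and denominators of weights in binary (lowest digit first). *)

Definition enc_unary (n : nat) : seq bool := rcons (nseq n true) false.

Definition enc_seq (T : Type) (f : T -> seq bool) (s : seq T) : seq bool :=
  rcons (flatten [seq true :: f x | x <- s]) false.

Definition binary_digits (n : nat) : seq bool :=
  mkseq (fun i => odd (n %/ 2 ^ i)%N) (trunc_log 2 n).+1.

Definition enc_int (z : int) : seq bool :=
  (z < 0) :: enc_seq (fun d => [:: d]) (binary_digits `|z|%N).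

Definition enc_rat (q : rat) : seq bool := enc_int (numq q) ++ enc_int (denq q).

(* The dimensions of A are not part of the code of A. *)
Definition enc_mx (m n : nat) (A : 'M[rat]_(m, n)) : seq bool :=
  flatten [seq enc_rat (A i j) | i <- enum 'I_m, j <- enum 'I_n].

(* The literal (i, true) is the variable i, and (i, false) its negation. *)
Definition literal (n : nat) : Type := 'I_n * bool.

Definition clause3 (n : nat) : Type := 3.-tuple (literal n).

Record cnf3 := Cnf3 { nvars : nat; clauses : seq (clause3 nvars) }.

Definition satisfies (n : nat) (a : 'I_n -> bool) (cs : seq (clause3 n)) : bool :=
  all (fun c : clause3 n => has (fun l : literal n => a l.1 == l.2) c) cs.

Definition satisfiable (phi : cnf3) : Prop :=
  exists a : 'I_(nvars phi) -> bool, satisfies a (clauses phi).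

Definition enc_clause (n : nat) (c : clause3 n) : seq bool :=
  flatten [seq l.2 :: enc_unary l.1 | l : literal n <- c].

Definition enc_cnf3 (phi : cnf3) : seq bool :=
  enc_unary (nvars phi) ++ enc_seq (@enc_clause _) (clauses phi).

Definition three_sat : problem :=
  {| instance := cnf3; code := enc_cnf3; param := nvars; yes := satisfiable |}.

Definition ETH (R : realType) : Prop := exp_hard R three_sat.

(* relu_net T n L m: the L-layer networks from T^n to T^m; note that L >= 1. *)
Inductive relu_net (T : Type) (n : nat) : nat -> nat -> Type :=
| FirstLayer (m : nat) (W : 'M[T]_(m, n)) (b : 'cV[T]_m) : relu_net T n 1 m
| NextLayer (L k m : nat) (G : relu_net T n L k)
    (W : 'M[T]_(m, k)) (b : 'cV[T]_m) : relu_net T n L.+1 m.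

Fixpoint net_width (T : Type) (n L m : nat) (G : relu_net T n L m) : nat :=
  match G with
  | @FirstLayer _ _ m' _ _ => m'
  | @NextLayer _ _ _ _ m' G' _ _ => maxn (net_width G') m'
  end.

Definition relu (R : realType) (m : nat) (v : 'cV[R]_m) : 'cV[R]_m :=
  map_mx (fun t => Num.max t 0) v.

Fixpoint net_eval (R : realType) (n L m : nat) (G : relu_net R n L m)
    (z : 'cV[R]_n) : 'cV[R]_m :=
  match G with
  | FirstLayer _ W b => relu (W *m z + b)
  | NextLayer _ _ _ G' W b => relu (W *m net_eval G' z + b)
  end.

Fixpoint net_map (T U : Type) (f : T -> U) (n L m : nat)
    (G : relu_net T n L m) : relu_net U n L m :=
  match G with
  | FirstLayer _ W b => FirstLayer (map_mx f W) (map_mx f b)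
  | NextLayer _ _ _ G' W b =>
      NextLayer (net_map f G') (map_mx f W) (map_mx f b)
  end.

Fixpoint enc_net (n L m : nat) (G : relu_net rat n L m) : seq bool :=
  match G with
  | @FirstLayer _ _ m' W b => enc_unary m' ++ enc_mx W ++ enc_mx b
  | @NextLayer _ _ _ _ m' G' W b =>
      enc_net G' ++ enc_unary m' ++ enc_mx W ++ enc_mx b
  end.

Definition lp_norm (R : realType) (p m : nat) (v : 'cV[R]_m) : R :=
  (\sum_(i < m) `|v i 0| ^+ p) `^ (p%:R^-1).

(* The network and the observation have rational entries, so that they can be
   given to a machine; the latent vector that is sought is real. *)
Record inversion_instance (L C : nat) := InversionInstance {
  latent_dim : nat;
  out_dim : nat;
  net : relu_net rat latent_dim L out_dim;
  observation : 'cV[rat]_out_dim;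
  net_width_le : (net_width net <= C * latent_dim ^ 2)%N
}.

Definition enc_inversion (L C : nat) (I : inversion_instance L C) : seq bool :=
  enc_unary (latent_dim I) ++ enc_net (net I) ++ enc_mx (observation I).

Definition approx_invertible (R : realType) (L C p : nat) (delta : R)
    (I : inversion_instance L C) : Prop :=
  exists z : 'cV[R]_(latent_dim I),
    lp_norm p (net_eval (net_map ratr (net I)) z - map_mx ratr (observation I))
    <= delta.

(* L is the number of layers, and C the constant in the width bound C n^2. *)
Definition approx_inversion (R : realType) (L C p : nat) (delta : R) : problem :=
  {| instance := inversion_instance L C;
     code := @enc_inversion L C;
     param := @latent_dim L C;
     yes := @approx_invertible R L C p delta |}.

(* Main.v *)
(* The network. Number the 2N literals of N = n + 1 variables. The truth value of a
   literal is computed from a real latent vector z as g = max(1 - max(1 -/+ z_i, 0), 0)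
   in [0, 1]; if the assignment "z_i >= 0" falsifies the literal then g = 0 exactly, so
   no real vector can cheat. There may be order n^3 clauses but only O(n^2) units: the
   unit of the pair (a, b) handles all clauses (a, b, c) at once, by
   max(- M (g_a + g_b) + B * sum of the 1 - g_c, 0) with M much larger than B. It is
   at least B if one of these clauses is falsified and 0 if all are satisfied; B > delta
   and x = 0 give the gap, for every p.

   The machine. A program in a small structured language writes the code of this
   network on a tape, on which the given machine for approximate inversion is then
   started. Every loop of the program scans a tape, so the number of its iterations
   is polynomially bounded and so is the running time. *)
Require Import Defs.
From mathcomp Require Import all_boot all_order all_algebra.
From mathcomp Require Import reals exp.
From mathcomp Require Import zify ring lra.

Set Implicit Arguments.
Unset Strict Implicit.
Unset Printing Implicit Defensive.

Import Order.TTheory GRing.Theory Num.Theory.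

Local Open Scope nat_scope.

(** * Tapes up to trailing blanks *)

(** Lists that differ only by trailing blanks stand for the same half of a tape, and [tape_act] may
    list blanks explicitly; all simulations are therefore up to this relation. *)
Definition cells_eq (u v : seq cell) : Prop := forall i, nth None u i = nth None v i.

Definition tape_eq (t u : tape) : Prop := cells_eq t.1 u.1 /\ cells_eq t.2 u.2.

Lemma tape_eq_trans t u v : tape_eq t u -> tape_eq u v -> tape_eq t v.
Proof. by move=> [h1 h2] [h3 h4]; split=> i; rewrite ?h1 ?h2. Qed.

Lemma cells_eq_behead u v : cells_eq u v -> cells_eq (behead u) (behead v).
Proof. by move=> h i; rewrite !nth_behead. Qed.

Lemma cells_eq_cons c u v : cells_eq u v -> cells_eq (c :: u) (c :: v).
Proof. by move=> h [|i] /=. Qed.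

Lemma cells_eq_head u v : cells_eq u v -> head None u = head None v.
Proof. by move=> h; rewrite -!nth0. Qed.

Lemma tape_read_eq t u : tape_eq t u -> tape_read t = tape_read u.
Proof. by case=> _ /cells_eq_head. Qed.

Lemma tape_act_eq a t u : tape_eq t u -> tape_eq (tape_act a t) (tape_act a u).
Proof.
case: t u a => [l r] [l' r'] [c []] [/= hl hr]; rewrite /tape_act /=.
- split; first exact: cells_eq_behead.
  rewrite (cells_eq_head hl); do 2!apply: cells_eq_cons.
  exact: cells_eq_behead.
- by split=> //; apply: cells_eq_cons; apply: cells_eq_behead.
- by split=> //=; [apply: cells_eq_cons | apply: cells_eq_behead].
Qed.

(** Writing back the symbol read is how an idle tape is treated. On an empty right part it lists a
    blank, so plain equality fails. *)
Lemma tape_act_stay t : tape_eq (tape_act (tape_read t, Stay) t) t.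
Proof. by case: t => l [|c r] //; split=> // -[|[]]. Qed.

Definition tape_size (t : tape) : nat := size t.1 + size t.2.

(** The growth by two occurs on the empty tape, where [MoveLeft] lists both the written cell and a
    new blank. *)
Lemma tape_act_size a t : tape_size (tape_act a t) <= tape_size t + 2.
Proof.
case: t a => [l r] [c []]; rewrite /tape_act /tape_size /= !size_behead.
- by case: (size l) (size r) => [|x] [|y] /=; lia.
- by case: (size r) => [|y] /=; lia.
- by case: (size r) => [|y] /=; lia.
Qed.

(** * Structured programs *)

(** [TI] holds the formula and [TO] receives the code of the network. [TA], [TB], [TC] have one cell
    per literal and [TD] one per variable; they serve as counters and as one-hot codes. *)
Inductive tid := TI | TA | TB | TC | TD | TO.

Record store := Store { tI : tape; tA : tape; tB : tape; tC : tape; tD : tape; tO : tape }.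

Definition get (i : tid) (s : store) : tape :=
  match i with
  | TI => tI s | TA => tA s | TB => tB s | TC => tC s | TD => tD s | TO => tO s
  end.

Definition set (i : tid) (t : tape) (s : store) : store :=
  let: Store a b c d e f := s in
  match i with
  | TI => Store t b c d e f | TA => Store a t c d e f | TB => Store a b t d e f
  | TC => Store a b c t e f | TD => Store a b c d t f | TO => Store a b c d e t
  end.

Definition rd (i : tid) (s : store) : cell := tape_read (get i s).

Lemma get_set i t s : get i (set i t s) = t.
Proof. by case: i s => -[]. Qed.

Lemma set_set i t u s : set i t (set i u s) = set i t s.
Proof. by case: i s => -[]. Qed.

Lemma set_get i s : set i (get i s) s = s.
Proof. by case: i s => -[]. Qed.

Lemma set_getE i t s : get i s = t -> set i t s = s.
Proof. by move=> <-; apply: set_get. Qed.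

Lemma set_comm i j t u s : i <> j -> set i t (set j u s) = set j u (set i t s).
Proof. by case: s; case: i; case: j. Qed.

Lemma get_set_ne i j t s : i <> j -> get i (set j t s) = get i s.
Proof. by case: s; case: i; case: j. Qed.

Inductive prog :=
| Act (i : tid) (f : cell -> cell * move)
| Seq (p q : prog)
| If (i : tid) (f : pred cell) (p q : prog)
| While (i : tid) (f : pred cell) (p : prog).

(* S bounds the number of iterations of every loop, so that the running time
   is at most cost S p, whatever the data. *)
Fixpoint run (S : nat) (p : prog) (s s' : store) : Prop :=
  match p with
  | Act i f =>
      exists2 t, tape_eq t (tape_act (f (rd i s)) (get i s)) & s' = set i t s
  | Seq p q => exists2 u, run S p s u & run S q u s'
  | If i f p q => if f (rd i s) then run S p s s' else run S q s s'
  | While i f p => exists k st, [/\ k <= S, st 0 = s, st k = s',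
      ~~ f (rd i (st k))
      & forall j, j < k -> f (rd i (st j)) /\ run S p (st j) (st j.+1)]
  end.

Fixpoint cost (S : nat) (p : prog) : nat :=
  match p with
  | Act _ _ => 1
  | Seq p q => cost S p + cost S q
  | If _ _ p q => (cost S p + cost S q).+1
  | While _ _ p => (S * (cost S p).+1).+1
  end.

(** A nested loop raises the degree by one, so the degree depends on the program only. *)
Lemma cost_poly p : exists K k, forall S, cost S p <= K * S.+1 ^ k.
Proof.
elim: p => [i f|p [K [k hp]] q [K' [k' hq]]|i f p [K [k hp]] q [K' [k' hq]]|i f p [K [k hp]]].
- by exists 1, 0.
- exists (K + K'), (k + k') => S /=.
  rewrite mulnDl; apply: leq_add.
  + by apply: leq_trans (hp S) _; rewrite leq_mul2l leq_pexp2l ?leq_addr ?orbT.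
  + by apply: leq_trans (hq S) _; rewrite leq_mul2l leq_pexp2l ?leq_addl ?orbT.
- exists (K + K').+1, (k + k') => S /=.
  rewrite mulSn mulnDl -add1n; apply: leq_add; first by rewrite expn_gt0.
  apply: leq_add.
  + by apply: leq_trans (hp S) _; rewrite leq_mul2l leq_pexp2l ?leq_addr ?orbT.
  + by apply: leq_trans (hq S) _; rewrite leq_mul2l leq_pexp2l ?leq_addl ?orbT.
- exists K.+2, k.+1 => S /=.
  rewrite expnS mulnCA -[(_ * _).+1]add1n mulSn.
  have := hp S; have : 0 < S.+1 ^ k by rewrite expn_gt0.
  move: (cost S p) (S.+1 ^ k) => x y hy hx.
  rewrite -/(x.+1); nia.
Qed.

(** The states are the positions in the program text; the extra [None] of [If] and [While] is the
    position at which the test is evaluated. *)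
Fixpoint pstate (p : prog) : finType :=
  match p with
  | Act _ _ => unit
  | Seq p q => (pstate p + pstate q)%type
  | If _ _ p q => option (pstate p + pstate q)%type
  | While _ _ p => option (pstate p)
  end.

Fixpoint pinit (p : prog) : pstate p :=
  match p with
  | Act _ _ => tt
  | Seq p q => inl (pinit p)
  | If _ _ p q => None
  | While _ _ p => None
  end.

Definition noop (r : tid -> cell) : tid * (cell * move) := (TI, (r TI, Stay)).

(* The state None of the result means that the program has terminated. *)
Fixpoint pnext (p : prog) : pstate p -> (tid -> cell) ->
    option (pstate p) * (tid * (cell * move)) :=
  match p with
  | Act i f => fun _ r => (None, (i, f (r i)))
  | Seq p q => fun x r =>
      match x with
      | inl y => let: (o, a) := pnext y r in
          (Some (if o is Some y' then inl y' else inr (pinit q)), a)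
      | inr y => let: (o, a) := pnext y r in
          (if o is Some y' then Some (inr y') else None, a)
      end
  | If i f p q => fun x r =>
      match x with
      | None => (Some (Some (if f (r i) then inl (pinit p) else inr (pinit q))), noop r)
      | Some (inl y) => let: (o, a) := pnext y r in
          (if o is Some y' then Some (Some (inl y')) else None, a)
      | Some (inr y) => let: (o, a) := pnext y r in
          (if o is Some y' then Some (Some (inr y')) else None, a)
      end
  | While i f p => fun x r =>
      match x with
      | None => (if f (r i) then Some (Some (pinit p)) else None, noop r)
      | Some y => let: (o, a) := pnext y r in
          (Some (if o is Some y' then Some y' else None), a)
      end
  end.

Definition idx (i : tid) : nat :=
  match i with TI => 0 | TA => 1 | TB => 2 | TC => 3 | TD => 4 | TO => 5 end.

(** * Compilation of a program and its composition with a machine *)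

Section Combine.

Variables (M : machine) (p0 : prog).

Let n := (ntapes M).+1.

(** Tapes 0 to 4 are private to the program. Tape 5 is both [TO] and the tape [ord0] of [M], since
    the tapes of [M] are shifted by 5. *)
Definition tord (i : tid) : 'I_(5 + n) := inord (idx i).

Lemma tordE i : tord i = idx i :> nat.
Proof. by rewrite /tord inordK //; case: i. Qed.

Definition prog_acts (c : (5 + n).-tuple cell) (a : tid * (cell * move)) :
    (5 + n).-tuple (cell * move) :=
  [tuple if j == tord a.1 then a.2 else (tnth c j, Stay) | j < 5 + n].

Definition machine_acts (c : (5 + n).-tuple cell) (a : n.-tuple (cell * move)) :
    (5 + n).-tuple (cell * move) :=
  [tuple if split j is inr j' then tnth a j' else (tnth c j, Stay) | j < 5 + n].

Definition ctrans (q : pstate p0 + state M) (c : (5 + n).-tuple cell) :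
    (pstate p0 + state M) * (5 + n).-tuple (cell * move) :=
  match q with
  | inl x =>
      let: (o, a) := pnext x (fun i => tnth c (tord i)) in
      (if o is Some y then inl y else inr (start M), prog_acts c a)
  | inr y =>
      let: (y', a) := trans y [tuple tnth c (rshift 5 j) | j < n] in
      (inr y', machine_acts c a)
  end.

(* Runs p0, then M; the output tape of p0 is the input tape of M. *)
Definition combine : machine :=
  @Machine (4 + n) (pstate p0 + state M)%type (inl (pinit p0))
    (fun q => if q is inr y then verdict y else None) ctrans.

(** The tapes after the fifth are the work tapes of [M], still blank while the program runs. *)
Definition conc (s : store) (j : nat) : tape :=
  match j with
  | 0 => tI s | 1 => tA s | 2 => tB s | 3 => tC s | 4 => tD s | 5 => tO s
  | _ => ([::], [::])
  end.

Definition agree (T : (5 + n).-tuple tape) (s : store) : Prop :=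
  forall j, tape_eq (tnth T j) (conc s j).

Lemma conc_idx s i : conc s (idx i) = get i s.
Proof. by case: i. Qed.

Lemma conc_set s i t j : conc (set i t s) j = if j == idx i then t else conc s j.
Proof. by case: s => *; case: i; do 7?[case: j => [|j] //]. Qed.

Definition reads (T : (5 + n).-tuple tape) : (5 + n).-tuple cell :=
  [tuple tape_read (tnth T j) | j < 5 + n].

Lemma agree_read T s i : agree T s -> tnth (reads T) (tord i) = rd i s.
Proof.
by move=> /(_ (tord i)) h; rewrite tnth_mktuple (tape_read_eq h) tordE conc_idx.
Qed.

Definition act_tapes (T : (5 + n).-tuple tape) (a : (5 + n).-tuple (cell * move)) :
    (5 + n).-tuple tape :=
  [tuple tape_act (tnth a j) (tnth T j) | j < 5 + n].

Lemma agree_act T s i a t : agree T s -> tape_eq t (tape_act a (get i s)) ->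
  agree (act_tapes T (prog_acts (reads T) (i, a))) (set i t s).
Proof.
move=> hT ht j; rewrite !tnth_mktuple conc_set -tordE /=.
have -> : (nat_of_ord j == tord i :> nat) = (j == tord i) by [].
case: eqP => [->|_].
  have h := hT (tord i); rewrite tordE conc_idx in h.
  have [h1 h2] := tape_act_eq a h; case: ht => h3 h4.
  by split=> k; rewrite ?h1 ?h2 ?h3 ?h4.
exact: tape_eq_trans (tape_act_stay _) (hT j).
Qed.

Lemma agree_noop T s : agree T s ->
  agree (act_tapes T (prog_acts (reads T) (noop (fun i => tnth (reads T) (tord i))))) s.
Proof.
move=> hT; rewrite -[s in agree _ s](set_get TI); apply: agree_act => //.
rewrite (agree_read _ hT); have [h1 h2] := tape_act_stay (get TI s).
by split=> k; rewrite ?h1 ?h2.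
Qed.

(** [e (Some x)] is the state of the whole machine when a subprogram is in state [x], and [e None]
    is the state from which the control continues after it. *)
Definition embeds (p : prog) (e : option (pstate p) -> pstate p0 + state M) : Prop :=
  forall T x, @step combine (e (Some x), T) =
    (e (pnext x (fun i => tnth (reads T) (tord i))).1,
     act_tapes T (prog_acts (reads T) (pnext x (fun i => tnth (reads T) (tord i))).2)).

Definition reaches (b : nat) (q : pstate p0 + state M) (s : store)
    (q' : pstate p0 + state M) (s' : store) : Prop :=
  forall T, agree T s -> exists t T', [/\ t <= b, agree T' s' &
    iter t (@step combine) (q, T) = (q', T')].

Lemma reaches_trans b b' q s q' s' q'' s'' :
  reaches b q s q' s' -> reaches b' q' s' q'' s'' -> reaches (b + b') q s q'' s''.
Proof.
move=> h h' T /h [t [T' [tb /h' [t' [T'' [tb' hT e']]] e]]].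
by exists (t' + t), T''; split=> //; [rewrite addnC leq_add | rewrite iterD e].
Qed.

Lemma reaches_refl q s : reaches 0 q s q s.
Proof. by move=> T hT; exists 0, T. Qed.

Lemma reaches_le b b' q s q' s' : b <= b' -> reaches b q s q' s' -> reaches b' q s q' s'.
Proof.
by move=> hb h T /h [t [T' [tb ? ?]]]; exists t, T'; split=> //; apply: leq_trans hb.
Qed.

Lemma reaches_step q s q' s' :
  (forall T, agree T s -> exists2 T', agree T' s' & @step combine (q, T) = (q', T')) ->
  reaches 1 q s q' s'.
Proof. by move=> h T /h[T' hT e]; exists 1, T'. Qed.

(** Induction on [p] for an arbitrary embedding: a subprogram runs under its own embedding, whose
    value at [None] is the entry of what follows, namely the second half of a sequence, the test of
    a loop, or the exit. *)
Lemma run_reaches S p (e : option (pstate p) -> pstate p0 + state M) s s' :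
  embeds e -> run S p s s' -> reaches (cost S p) (e (Some (pinit p))) s (e None) s'.
Proof.
elim: p e s s' => [i f|p IHp q IHq|i f p IHp q IHq|i f p IHp] e s s' he.
- move=> [t ht ->]; apply: reaches_step => T hT; rewrite he /=.
  by eexists; last by []; rewrite (agree_read _ hT); apply: agree_act.
- move=> [u hp hq] /=.
  pose e1 o := e (Some (if o is Some x then inl x else inr (pinit q))).
  pose e2 o := e (if o is Some x then Some (inr x) else None).
  apply: reaches_trans (IHp e1 _ _ _ hp) (IHq e2 _ _ _ hq).
    by move=> T x; rewrite /e1 he /=; case: pnext.
  by move=> T x; rewrite /e2 he /=; case: pnext.
- move=> h.
  pose e1 o := e (if o is Some x then Some (Some (inl x)) else None).
  pose e2 o := e (if o is Some x then Some (Some (inr x)) else None).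
  have he1 : embeds e1 by move=> T x; rewrite /e1 he /=; case: pnext.
  have he2 : embeds e2 by move=> T x; rewrite /e2 he /=; case: pnext.
  have h0 : reaches 1 (e (Some (pinit (If i f p q)))) s
     (e (Some (Some (if f (rd i s) then inl (pinit p) else inr (pinit q))))) s.
    apply: reaches_step => T hT; rewrite he /= (agree_read _ hT).
    by eexists; last by []; apply: agree_noop.
  rewrite [cost _ _]/= -add1n; apply: reaches_trans h0 _.
  move: h => /=; case: ifP => _ h.
    by apply: reaches_le (leq_addr _ _) _; apply: (IHp e1).
  by apply: reaches_le (leq_addl _ _) _; apply: (IHq e2).
- move=> [k [st [hk <- <- hf h]]].
  pose e1 o := e (Some (if o is Some x then Some x else None)).
  have he1 : embeds e1 by move=> T x; rewrite /e1 he /=; case: pnext.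
  (* Each of the [k] iterations costs one test and one body; the last unit is the failing test. *)
  apply: (@reaches_le (k * (cost S p).+1).+1).
    by rewrite ltnS leq_mul2r hk orbT.
  have h0 j : reaches 1 (e (Some None)) (st j)
     (e (if f (rd i (st j)) then Some (Some (pinit p)) else None)) (st j).
    apply: reaches_step => T hT; rewrite he /= (agree_read _ hT).
    by eexists; last by []; apply: agree_noop.
  rewrite -addn1; apply: (@reaches_trans _ _ _ _ (e (Some None)) (st k)); last first.
    by have := h0 k; rewrite (negbTE hf).
  elim: k h {hf hk} => [|k IHk] h; first exact: reaches_refl.
  rewrite mulSn addnC; apply: reaches_trans (IHk _) _.
    by move=> j jk; apply: h; apply: ltnW.
  have [hf hr] := h k (ltnSn k).
  rewrite -add1n; apply: reaches_trans; first by have := h0 k; rewrite hf; apply.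
  exact: (IHp e1).
Qed.

Lemma combine_run_prog S s s' : run S p0 s s' ->
  reaches (cost S p0) (inl (pinit p0)) s (inr (start M)) s'.
Proof.
pose e (o : option (pstate p0)) : pstate p0 + state M :=
  if o is Some x then inl x else inr (start M).
apply: (@run_reaches S p0 e) => T x; rewrite /step /= /ctrans -/(reads T).
by case: pnext.
Qed.

(** Lockstep simulation: the tapes agree up to trailing blanks, so the same symbols are read and the
    same transitions are taken. *)
Lemma combine_run_machine t q (T : (5 + n).-tuple tape) (T0 : n.-tuple tape) :
  (forall j, tape_eq (tnth T (rshift 5 j)) (tnth T0 j)) ->
  (iter t (@step combine) (inr q, T)).1 = inr (iter t (@step M) (q, T0)).1.
Proof.
suff h : forall c (c0 : config M), c.1 = inr c0.1 ->
    (forall j, tape_eq (tnth c.2 (rshift 5 j)) (tnth c0.2 j)) ->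
    (iter t (@step combine) c).1 = inr (iter t (@step M) c0).1.
  by move=> hT; apply: h.
elim: t => [|t IHt] // c c0 e hT; rewrite !iterSr; apply: IHt.
  rewrite /step e /=; case: (verdict c0.1) => // {e}.
  have -> : [tuple tnth [tuple tape_read (tnth c.2 i) | i < (4 + n).+1] (rshift 5 j) | j < n]
     = [tuple tape_read (tnth c0.2 i) | i < n].
    by apply: eq_from_tnth => j; rewrite !tnth_mktuple (tape_read_eq (hT j)).
  by case: trans.
move=> j; rewrite /step e /=; case: (verdict c0.1) => [b|]; first exact: hT.
have -> : [tuple tnth [tuple tape_read (tnth c.2 i) | i < (4 + n).+1] (rshift 5 j) | j < n]
   = [tuple tape_read (tnth c0.2 i) | i < n].
  by apply: eq_from_tnth => k; rewrite !tnth_mktuple (tape_read_eq (hT k)).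
case: trans => y a /=; rewrite !tnth_mktuple.
case: split_ordP => k; first by move/eqP; rewrite eq_rlshift.
by move/rshift_inj=> <-; apply: tape_act_eq.
Qed.

End Combine.

Lemma step_size (M : machine) (c : config M) j :
  tape_size (tnth (step c).2 j) <= tape_size (tnth c.2 j) + 2.
Proof.
rewrite /step; case: verdict => [_|]; first exact: leq_addr.
by case: trans => q a /=; rewrite tnth_mktuple; apply: tape_act_size.
Qed.

Lemma iter_step_size (M : machine) t (c : config M) j :
  tape_size (tnth (iter t (@step M) c).2 j) <= tape_size (tnth c.2 j) + t.*2.
Proof.
elim: t => [|t IHt]; first by rewrite addn0.
rewrite iterS; apply: leq_trans (step_size _ _) _.
by rewrite doubleS -[t.*2.+2]addn2 addnA leq_add2r.
Qed.

Arguments run : simpl never.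

(** * Elementary programs *)

(* The head is on the first cell of r, and l is in reverse order. *)
Definition tp (l r : seq bool) : tape := (map Some l, map Some r).

Definition pos (j : nat) (r : seq bool) : tape := tp (rev (take j r)) (drop j r).

Lemma pos0 r : pos 0 r = tp [::] r.
Proof. by rewrite /pos take0 drop0. Qed.

Definition keep (c : move) : cell -> cell * move := fun a => (a, c).
Definition skip : prog := Act TI (keep Stay).
Definition mvL (i : tid) : prog := Act i (keep MoveLeft).
Definition mvR (i : tid) : prog := Act i (keep MoveRight).
Definition put (i : tid) (b : bool) : prog := Act i (fun _ => (Some b, MoveRight)).
Definition mark (i : tid) (b : bool) : prog := Act i (fun _ => (Some b, Stay)).
(** The first move lets the head start on the blank behind the word; the last one returns from the
    blank in front of it. *)
Definition rewind (i : tid) : prog :=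
  Seq (mvL i) (Seq (While i isSome (mvL i)) (mvR i)).

Definition is_one : pred cell := pred1 (Some true).
Definition is_zero : pred cell := pred1 (Some false).

Section Runs.

Variable S : nat.

Lemma run_ifE i (f : pred cell) p q s s' :
  run S (If i f p q) s s' = if f (rd i s) then run S p s s' else run S q s s'.
Proof. by []. Qed.

Lemma run_set p i t u s :
  run S p (set i t s) (set i u (set i t s)) -> run S p (set i t s) (set i u s).
Proof. by rewrite set_set. Qed.

Lemma run_skip s : run S skip s s.
Proof.
exists (get TI s); last by rewrite set_get.
by have [h1 h2] := tape_act_stay (get TI s); split=> k; rewrite ?h1 ?h2.
Qed.

Lemma run_mvR i s l b r : get i s = tp l (b :: r) ->
  run S (mvR i) s (set i (tp (b :: l) r) s).
Proof. by move=> h; eexists; last by []; rewrite /rd h /=. Qed.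

Lemma run_mvR_pos i s j r : get i s = pos j r -> j < size r ->
  run S (mvR i) s (set i (pos j.+1 r) s).
Proof.
move=> h hj; rewrite /pos (take_nth false hj) rev_rcons; apply: run_mvR.
by rewrite h /pos (drop_nth false hj).
Qed.

Lemma run_put i s l r b : get i s = tp l r ->
  run S (put i b) s (set i (tp (b :: l) (behead r)) s).
Proof. by move=> h; eexists; last by []; rewrite h /=; case: r h. Qed.

Lemma run_mark i s l r b b' : get i s = tp l (b' :: r) ->
  run S (mark i b) s (set i (tp l (b :: r)) s).
Proof. by move=> h; eexists; last by []; rewrite h. Qed.

Lemma run_rewind i s l r : get i s = tp l r -> size l <= S ->
  run S (rewind i) s (set i (tp [::] (rev l ++ r)) s).
Proof.
move=> h hl.
(* The tape with the head on cell [j] of [l]; at [j = size l] the default value [None] is the blank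
   in front of the word. *)
pose t j : tape := (map Some (drop j.+1 l),
  nth None (map Some l) j :: map Some (rev (take j l) ++ r)).
exists (set i (t 0) s).
  exists (t 0) => //; rewrite /rd h /t /tape_act /=.
  by case: l {h hl t} => [|b l]; case: r => [|c r]; rewrite ?take0 /= ?drop0;
    split=> // -[|[|[]]].
exists (set i (t (size l)) s).
  exists (size l), (fun j => set i (t j) s); split=> //.
    by rewrite /rd get_set /t /tape_read /= nth_default ?size_map.
  move=> j hj; rewrite /rd get_set /t /tape_read /= (nth_map false None Some hj) //; split=> //.
  exists (t j.+1); last by rewrite set_set.
  rewrite /rd get_set /t /tape_act /tape_read /=.
  split=> /= k; first by rewrite nth_behead !map_drop !nth_drop addSnnS.
  case: k => [|k] /=; first by rewrite -nth0 map_drop nth_drop addn0.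
  by rewrite (take_nth false hj) rev_rcons.
exists (tp [::] (rev l ++ r)); last by rewrite set_set.
rewrite /rd get_set /t take_size drop_oversize // /tape_act /= nth_default ?size_map //.
by split=> // -[|[]].
Qed.

Lemma run_rewind_pos i s j r : get i s = pos j r -> j <= S ->
  run S (rewind i) s (set i (pos 0 r) s).
Proof.
move=> h hj; have := run_rewind h; rewrite /pos revK cat_take_drop take0 drop0; apply.
by rewrite size_rev size_take_min; apply: leq_trans (geq_minl _ _) hj.
Qed.

Lemma read_pos j r : tape_read (pos j r) = if j < size r then Some (nth false r j) else None.
Proof.
case: ltnP => hj; first by rewrite /pos (drop_nth false hj).
by rewrite /pos drop_oversize.
Qed.

(** All tapes but [TO] are restored, so that the words emitted by consecutive programs are simply
    concatenated. *)
Definition emits (p : prog) (s : store) (w : seq bool) : Prop :=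
  forall o, run S p (set TO (tp o [::]) s) (set TO (tp (rev w ++ o) [::]) s).

Fixpoint emit (w : seq bool) : prog :=
  if w is b :: w' then Seq (put TO b) (emit w') else skip.

Definition each (i : tid) (p : prog) : prog :=
  Seq (While i isSome (Seq p (mvR i))) (rewind i).

(** Meant for a tape of zeros. The current cell becomes 1 and the head goes back, so that [p] sees
    the one-hot code of the counter; the mark is then found again by skipping zeros, erased, and
    passed. *)
Definition for_hot (i : tid) (p : prog) : prog :=
  Seq (While i isSome
        (Seq (mark i true) (Seq (rewind i) (Seq p
          (Seq (While i is_zero (mvR i)) (put i false))))))
      (rewind i).

Definition onehot (m a : nat) : seq bool := nseq a false ++ true :: nseq (m - a.+1) false.

Lemma emits_emit w s : emits (emit w) s w.
Proof.
elim: w => [|b w IHw] o /=; first exact: run_skip.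
exists (set TO (tp (b :: o) [::]) s).
  by have := @run_put TO (set TO (tp o [::]) s) o [::] b; rewrite get_set set_set; apply.
by have := IHw (b :: o); rewrite rev_cons cat_rcons.
Qed.

Lemma emits_seq p q s w w' : emits p s w -> emits q s w' -> emits (Seq p q) s (w ++ w').
Proof.
by move=> hp hq o; exists (set TO (tp (rev w ++ o) [::]) s); rewrite ?rev_cat -?catA.
Qed.

Lemma emits_if i (f : pred cell) p q s w w' : i <> TO -> (f (rd i s) -> emits p s w) ->
  (~~ f (rd i s) -> emits q s w') ->
  emits (If i f p q) s (if f (rd i s) then w else w').
Proof.
move=> hi hp hq o; rewrite run_ifE /rd get_set_ne // -/(rd i s).
by case: (boolP (f _)) hp hq => hf hp hq; [apply: hp | apply: hq].
Qed.

Lemma emits_each i p s r (w : nat -> seq bool) : i <> TO ->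
  get i s = pos 0 r -> size r <= S ->
  (forall j, j < size r ->
     emits p (set i (pos j r) s) (w j)) ->
  emits (each i p) s (flatten (mkseq w (size r))).
Proof.
move=> hi hs hr hp o.
pose st j := set TO (tp (rev (flatten (mkseq w j)) ++ o) [::]) (set i (pos j r) s).
have stg j : get i (st j) = pos j r by rewrite /st get_set_ne // get_set.
exists (st (size r)).
  exists (size r), st; split=> //.
  - by rewrite /st (set_getE hs).
  - by rewrite /rd stg read_pos ltnn.
  move=> j hj; split; first by rewrite /rd stg read_pos hj.
  set u := set TO (tp (rev (flatten (mkseq w j.+1)) ++ o) [::]) (set i (pos j r) s).
  exists u; first by rewrite /u mkseqS flatten_rcons rev_cat -catA; apply: hp.
  have -> : st j.+1 = set i (pos j.+1 r) u by rewrite /u (set_comm _ _ _ hi) set_set.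
  by apply: run_mvR_pos; rewrite // /u get_set_ne // get_set.
have := run_rewind_pos (stg (size r)) hr.
by rewrite {2}/st (set_comm _ _ _ hi) set_set (set_getE hs).
Qed.

Lemma emits_row i p q s r w w' : i <> TO -> get i s = pos 0 r -> size r <= S ->
  (forall j, emits p (set i (pos j r) s) w) -> (forall j, emits q (set i (pos j r) s) w') ->
  emits (each i (If i is_one p q)) s
    (flatten (mkseq (fun j => if nth false r j then w else w') (size r))).
Proof.
move=> hi hs hr hp hq; apply: emits_each => // j hj.
have := @emits_if i is_one p q (set i (pos j r) s) w w' hi (fun _ => hp j) (fun _ => hq j).
by rewrite /rd get_set read_pos hj /is_one /=; case: nth.
Qed.

Lemma onehotS m a : a < m -> size (onehot m a) = m.
Proof. by move=> h; rewrite /onehot size_cat /= !size_nseq; lia. Qed.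

Lemma nth_onehot m a j : a < m -> nth false (onehot m a) j = (j == a).
Proof.
move=> h; rewrite /onehot nth_cat size_nseq nth_nseq.
case: ltngtP => // [ja|->]; last by rewrite subnn.
by rewrite -(subnSK ja) /= nth_nseq if_same.
Qed.

Lemma run_seek i s b k r : get i s = tp [::] (nseq k b ++ ~~ b :: r) -> k <= S ->
  run S (While i (pred1 (Some b)) (mvR i)) s (set i (tp (nseq k b) (~~ b :: r)) s).
Proof.
move=> hs hk.
exists k, (fun j => set i (tp (nseq j b) (nseq (k - j) b ++ ~~ b :: r)) s).
split=> //; rewrite ?subn0 ?subnn //; first by rewrite (set_getE hs).
  by rewrite /rd get_set; case: b {hs}.
move=> j hj; rewrite /rd get_set -(subnSK hj); split; first exact: eqxx.
by apply: run_set; apply: (@run_mvR i _ (nseq j b) b); rewrite get_set.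
Qed.

Lemma emits_for_hot i p s m (w : nat -> seq bool) : i <> TO ->
  get i s = pos 0 (nseq m false) -> m <= S ->
  (forall a, a < m -> emits p (set i (pos 0 (onehot m a)) s) (w a)) ->
  emits (for_hot i p) s (flatten (mkseq w m)).
Proof.
move=> hi hs hm hp o; rewrite pos0 in hs.
pose st j := set TO (tp (rev (flatten (mkseq w j)) ++ o) [::])
               (set i (tp (nseq j false) (nseq (m - j) false)) s).
have sti j t : set i t (st j) = set TO (tp (rev (flatten (mkseq w j)) ++ o) [::]) (set i t s).
  by rewrite /st (set_comm _ _ _ hi) set_set.
have stg j : get i (st j) = tp (nseq j false) (nseq (m - j) false).
  by rewrite /st get_set_ne // get_set.
exists (st m).
  exists m, st; split=> //.
  - by rewrite /st subn0 (set_getE hs).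
  - by rewrite /rd stg subnn.
  move=> j hj; rewrite /rd stg -(subnSK hj); split=> //.
  set c := m - j.+1.
  exists (set i (tp (nseq j false) (true :: nseq c false)) (st j)).
    by apply: (@run_mark i _ _ _ true false); rewrite stg -(subnSK hj).
  exists (set i (tp [::] (onehot m j)) (st j)).
    have -> : onehot m j = rev (nseq j false) ++ true :: nseq c false by rewrite rev_nseq.
    by apply: run_set; apply: run_rewind; rewrite ?get_set // size_nseq; lia.
  exists (set TO (tp (rev (flatten (mkseq w j.+1)) ++ o) [::]) (set i (tp [::] (onehot m j)) s)).
    rewrite sti mkseqS flatten_rcons rev_cat -catA; have := hp j hj; rewrite pos0; apply.
  exists (set i (tp (nseq j false) (true :: nseq c false)) (st j.+1)).
    have -> : set TO (tp (rev (flatten (mkseq w j.+1)) ++ o) [::]) (set i (tp [::] (onehot m j)) s)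
      = set i (tp [::] (onehot m j)) (st j.+1) by rewrite sti.
    by apply: run_set; apply: (@run_seek i _ false); rewrite ?get_set //; lia.
  rewrite -[st j.+1 in X in run _ _ _ X](set_getE (stg j.+1)).
  by apply: run_set; apply: (@run_put i _ (nseq j false) (true :: nseq c false)); rewrite get_set.
have h := stg m.
rewrite subnn in h; have := run_rewind h; rewrite size_nseq rev_nseq cats0 => /(_ hm).
by rewrite sti (set_getE hs).
Qed.

End Runs.

(** * The network of a formula *)

(** With entries indexed by [nat], block decompositions of matrices become shifts of the index. *)
Definition mxn (m n : nat) (F : nat -> nat -> rat) : 'M[rat]_(m, n) :=
  \matrix_(i < m, j < n) F i j.

(* Literals are numbered 2 i for the negation of the variable i, 2 i + 1 for i. *)
Definition lit_index (n : nat) (l : literal n) : nat := l.1 * 2 + l.2.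

Lemma lit_index_lt n (l : literal n) : lit_index l < n.+1 * 2.
Proof. by rewrite /lit_index; case: l => l [] /=; have := ltn_ord l; lia. Qed.

Definition mem_clause (n : nat) (cs : seq (clause3 n)) (a b c : nat) : bool :=
  has (fun x : clause3 n => map (@lit_index n) x == [:: a; b; c]) cs.

Section Network.

Variables (beta n : nat) (cs : seq (clause3 n)).

(** The spare latent coordinate makes [m] positive, so that pairs of literals can be coded by
    quotient and remainder modulo [m]. *)
Let N := n.+1.
Let m := N * 2.
(** Since [m < 2 ^ m], this exceeds [m * scale] and dominates any sum over the clauses of one pair.
    As a power of two it has a code that can be written by scanning a tape of length [m]. *)
Let big : rat := (2%:R ^+ (beta + m))%R.
Let scale : rat := (2%:R ^+ beta)%R.

Definition W1 : nat -> nat -> rat := fun i j =>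
  if (j == i %/ 2)%N then (if odd i then -1 else 1)%R else 0%R.
Definition W2 : nat -> nat -> rat := fun i j => if j == i then (-1)%R else 0%R.
Definition W4 : nat -> nat -> rat := fun i j =>
  if i < m + m then (if (j == i %% m)%N then (-1)%R else 0%R)
  else if (j == i %% m)%N then 1%R else 0%R.
Definition b4 : nat -> nat -> rat := fun i _ => if i < m + m then 1%R else 0%R.
(** Row [i] is the pair [(i %/ m, i %% m)]. Two copies of [g] are read so that the weights of the
    two literals never fall on the same entry, even when the literals are equal. *)
Definition W5 : nat -> nat -> rat := fun i j =>
  if j < m then (if (j == i %/ m)%N then - big else 0)%R
  else if j < m + m then (if (j - m == i %% m)%N then - big else 0)%R
  else if mem_clause cs (i %/ m)%N (i %% m)%N (j - (m + m))%N then scale else 0%R.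
Definition one_col : nat -> nat -> rat := fun _ _ => 1%R.
Definition zero_col : nat -> nat -> rat := fun _ _ => 0%R.

(* With x the output of the first layer, i.e. max(1 - z_i, 0) or max(1 + z_i, 0)
   for the literal i resp. its negation, the second layer computes
   g = max(1 - x, 0), the third f = max(1 - g, 0) = 1 - g, the fourth (g, g, f),
   and the unit (a, b) of the last one
   max(- big * g_a - big * g_b + scale * sum of the f_c with (a, b, c) in cs, 0). *)
Definition sat_net : relu_net rat N 5 (m * m) :=
  NextLayer (NextLayer (NextLayer (NextLayer
    (FirstLayer (mxn m N W1) (mxn m 1 one_col))
    (mxn m m W2) (mxn m 1 one_col))
    (mxn m m W2) (mxn m 1 one_col))
    (mxn (m + m + m) m W4) (mxn (m + m + m) 1 b4))
    (mxn (m * m) (m + m + m) W5) (mxn (m * m) 1 zero_col).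

(** The widest layers have [m * m = 4 N ^ 2] and [3 m = 6 N] units, and [N] is at least 1. *)
Lemma sat_net_width : net_width sat_net <= 6 * N ^ 2.
Proof.
rewrite /= !geq_max -!andbA /m expnS expn1.
have : 0 < N by [].
by move: N => x hx; apply/and5P; split; nia.
Qed.

Definition sat_instance : inversion_instance 5 6 :=
  @InversionInstance 5 6 N (m * m) sat_net (mxn (m * m) 1 zero_col) sat_net_width.

End Network.

(** * The codes *)

Definition rows (m : nat) (w : nat -> seq bool) : seq bool := flatten (mkseq w m).

Lemma rows_add k l w : rows (k + l) w = rows k w ++ rows l (fun i => w (k + i)).
Proof.
by rewrite /rows /mkseq iotaD map_cat flatten_cat add0n -[X in iota X l]addn0 iotaDl -map_comp.
Qed.

Lemma eq_rows m w w' : (forall i, i < m -> w i = w' i) -> rows m w = rows m w'.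
Proof.
by move=> h; congr flatten; apply/eq_in_map => i; rewrite mem_iota => /h.
Qed.

Lemma rows_mul k l w : rows (k * l) w = rows k (fun a => rows l (fun b => w (a * l + b))).
Proof.
elim: k => [|k IHk] //; rewrite mulSnr rows_add IHk [in RHS]/rows mkseqS.
by rewrite flatten_rcons.
Qed.

Lemma rows_nseq k w : rows k (fun _ => w) = flatten (nseq k w).
Proof.
by rewrite /rows /mkseq; congr flatten; elim: k 0 => //= k IHk j; rewrite IHk.
Qed.

Lemma map_enum_ord (T : Type) (F : nat -> T) k : [seq F (val i) | i <- enum 'I_k] = mkseq F k.
Proof. by rewrite (map_comp F val) val_enum_ord. Qed.

Lemma enc_mxn m n F :
  enc_mx (mxn m n F) = rows m (fun i => rows n (fun j => enc_rat (F i j))).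
Proof.
rewrite /enc_mx /rows -(map_enum_ord (fun i => rows n (fun j => enc_rat (F i j)))).
elim: (enum 'I_m) => //= i s <-; rewrite flatten_cat; congr (_ ++ _).
rewrite /rows -(map_enum_ord (fun j => enc_rat (F i j))); congr flatten.
by apply: eq_map => j; rewrite mxE.
Qed.

Lemma enc_unaryE k : enc_unary k = rows k (fun _ => [:: true]) ++ [:: false].
Proof. by rewrite rows_nseq /enc_unary cats1; congr rcons; elim: k => //= k <-. Qed.

(** Lowest digit first, [2 ^ k] consists of [k] zeros and a one, each preceded by the continuation
    bit of [enc_seq]. Only a repeated block depends on [k], which makes the code easy to emit. *)
Lemma enc_rat_negpow k :
  enc_rat (- (2%:R ^+ k))%R
  = [:: true] ++ rows k (fun _ => [:: true; false]) ++ [:: true; true; false] ++ enc_int 1.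
Proof.
have e : (- (2%:R ^+ k) = (- (2 ^ k)%N%:Z)%:~R :> rat)%R by rewrite rmorphN /= -natrX.
rewrite /enc_rat e numq_int denq_int /enc_int abszN absz_nat.
have -> : (- (2 ^ k)%N%:Z < 0)%R by rewrite oppr_lt0 ltz_nat expn_gt0.
have -> : binary_digits (2 ^ k) = rcons (nseq k false) true.
  rewrite /binary_digits trunc_expnK // mkseqS divnn expn_gt0 /=; congr rcons.
  apply: (@eq_from_nth _ false); rewrite size_mkseq ?size_nseq // => i hi.
  rewrite nth_mkseq // nth_nseq hi -{1}(subnK (ltnW hi)) expnD mulnK ?expn_gt0 //.
  by rewrite oddX subn_eq0 leqNgt hi.
rewrite rows_nseq /enc_seq map_rcons flatten_rcons /=; congr (_ :: _).
by rewrite -cats1 -!catA /=; congr (_ ++ _); elim: k {e} => //= k ->.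
Qed.

(** * The reduction as a program *)

Definition grow : prog :=
  Seq (put TA false) (Seq (put TA false) (Seq (put TB false) (Seq (put TB false)
  (Seq (put TC false) (Seq (put TC false) (put TD false)))))).

(** The unary number of variables sets the lengths of the work tapes; the [grow] after the loop
    accounts for the spare variable. *)
Definition prepare : prog :=
  Seq (While TI is_one (Seq (mvR TI) grow)) (Seq (mvR TI) (Seq grow
  (Seq (rewind TA) (Seq (rewind TB) (Seq (rewind TC) (rewind TD)))))).

(** The head of [TI] starts on the cell before the sign bit and ends on the zero closing the unary
    index. Meanwhile the head of [i] moves by the sign and by two cells per unit, that is, to
    [lit_index]. *)
Definition read_literal (i : tid) : prog :=
  Seq (mvR TI) (Seq (If TI is_one (mvR i) skip) (Seq (mvR TI)
  (Seq (While TI is_one (Seq (mvR TI) (Seq (mvR i) (mvR i)))) skip))).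

(** Once the three heads stand on the cells of the three literals, comparison with the one-hot codes
    on [TA] and [TB] amounts to reading one cell of each. *)
Definition read_clause : prog :=
  Seq (read_literal TA) (Seq (read_literal TB) (Seq (read_literal TC)
  (Seq (mvR TI) (Seq (If TA is_one (If TB is_one (mark TC true) skip) skip)
  (Seq (rewind TA) (Seq (rewind TB) (rewind TC))))))).

(* When A and B hold the one-hot codes of a and b, fill marks on C the literals
   c such that (a, b, c) is a clause. *)
Definition fill : prog :=
  Seq (While TI is_one read_clause)
  (Seq (rewind TI) (Seq (While TI is_one (mvR TI)) (mvR TI))).

Definition clear : prog := Seq (While TC isSome (put TC false)) (rewind TC).

Section Runs.

Variable S : nat.

Lemma run_prepare n cl : n.+1 * 2 <= S ->
  run S prepare
    (Store (tp [::] (enc_unary n ++ cl)) (tp [::] [::]) (tp [::] [::]) (tp [::] [::])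
       (tp [::] [::]) (tp [::] [::]))
    (Store (tp (rev (enc_unary n)) cl) (pos 0 (nseq (n.+1 * 2) false))
       (pos 0 (nseq (n.+1 * 2) false)) (pos 0 (nseq (n.+1 * 2) false))
       (pos 0 (nseq n.+1 false)) (tp [::] [::])).
Proof.
move=> hS; have hn : n <= S by lia.
pose blk i j c := let z := tp (nseq (j * 2) false) [::] in
  Store (tp i c) z z z (tp (nseq j false) [::]) (tp [::] [::]).
have hgrow i j c : run S grow (blk i j c) (blk i j.+1 c).
  rewrite /grow /blk mulSn.
  do 6!(eexists; first by apply: run_put).
  by apply: (@run_put S TD _ (nseq j false) [::] false).
exists (blk (nseq n true) n (false :: cl)).
  exists n, (fun j => blk (nseq j true) j (nseq (n - j) true ++ false :: cl)); split=> //.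
  - by rewrite subn0 /blk /enc_unary cat_rcons.
  - by rewrite subnn.
  - by rewrite subnn.
  move=> j hj; rewrite -(subnSK hj); split=> //.
  by exists (blk (nseq j.+1 true) j (nseq (n - j.+1) true ++ false :: cl));
    [apply: (@run_mvR S TI _ (nseq j true) true) | apply: hgrow].
exists (blk (rev (enc_unary n)) n cl).
  rewrite /enc_unary rev_rcons rev_nseq; by apply: (@run_mvR S TI _ (nseq n true) false cl).
exists (blk (rev (enc_unary n)) n.+1 cl); first exact: hgrow.
rewrite /blk !pos0; set k := n.+1 * 2.
have e h : tp [::] (nseq h false) = tp [::] (rev (nseq h false) ++ [::]).
  by rewrite rev_nseq cats0.
rewrite !e.
eexists; first by apply: (@run_rewind S TA _ (nseq k false) [::]) => //; rewrite size_nseq.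
eexists; first by apply: (@run_rewind S TB _ (nseq k false) [::]) => //; rewrite size_nseq.
eexists; first by apply: (@run_rewind S TC _ (nseq k false) [::]) => //; rewrite size_nseq.
apply: (@run_rewind S TD _ (nseq n.+1 false) [::]) => //; rewrite size_nseq.
by apply: leq_trans hS; rewrite /k leq_pmulr.
Qed.

Lemma run_read_literal i s l b0 b k rest r : i <> TI ->
  get TI s = tp l (b0 :: b :: enc_unary k ++ rest) -> get i s = pos 0 r ->
  k * 2 + b < size r -> k <= S ->
  run S (read_literal i) s
    (set TI (tp (nseq k true ++ b :: b0 :: l) (false :: rest)) (set i (pos (k * 2 + b) r) s)).
Proof.
move=> hi hI hr hk hS.
pose st j := set TI (tp (nseq j true ++ b :: b0 :: l) (nseq (k - j) true ++ false :: rest))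
  (set i (pos (j * 2 + b) r) s).
have gi j t : get i (set TI t (set i (pos j r) s)) = pos j r.
  by rewrite get_set_ne // get_set.
have s0 : s = set TI (tp l (b0 :: b :: enc_unary k ++ rest)) (set i (pos 0 r) s).
  by rewrite (set_getE hr) (set_getE hI).
exists (set TI (tp (b0 :: l) (b :: enc_unary k ++ rest)) (set i (pos 0 r) s)).
  rewrite {1}s0; apply: run_set; rewrite -s0; exact: run_mvR.
exists (set TI (tp (b0 :: l) (b :: enc_unary k ++ rest)) (set i (pos b r) s)).
  rewrite run_ifE /rd get_set; case: b hk {hI st s0} => hk; last exact: run_skip.
  set u := set TI _ (set i (pos 0 r) s).
  have -> : set TI (tp (b0 :: l) (true :: enc_unary k ++ rest)) (set i (pos true r) s)
      = set i (pos 1 r) u by rewrite /u (set_comm _ _ _ hi) set_set.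
  by apply: run_mvR_pos; rewrite ?gi //; lia.
exists (st 0).
  rewrite /st mul0n add0n subn0 /enc_unary cat_rcons.
  by apply: run_set; apply: run_mvR; rewrite get_set.
exists (st k); last by have := run_skip S (st k); rewrite {2}/st subnn.
  exists k, st; split=> //.
    by rewrite /st /rd get_set subnn.
  move=> j hj; split; first by rewrite /st /rd get_set -(subnSK hj).
  pose u j' := set TI (tp (nseq j.+1 true ++ b :: b0 :: l)
    (nseq (k - j.+1) true ++ false :: rest)) (set i (pos j' r) s).
  have hu j' : j' < size r -> run S (mvR i) (u j') (u j'.+1).
    move=> hj'; have -> : u j'.+1 = set i (pos j'.+1 r) (u j').
      by rewrite /u (set_comm _ _ _ hi) set_set.
    by apply: run_mvR_pos; rewrite ?gi.
  exists (u (j * 2 + b)).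
    by rewrite /st -(subnSK hj); apply: run_set; apply: run_mvR; rewrite get_set.
  exists (u (j * 2 + b).+1); first by apply: hu; lia.
  by rewrite /st mulSnr addnAC addn2; apply: hu; lia.
Qed.

Lemma run_read_clause n (x : clause3 n) l rest ra rb rc D O :
  n <= S -> n * 2 <= S -> size ra = n.+1 * 2 -> size rb = n.+1 * 2 -> size rc = n.+1 * 2 ->
  run S read_clause
    (Store (tp l (true :: enc_clause x ++ rest)) (pos 0 ra) (pos 0 rb) (pos 0 rc) D O)
    (Store (tp (rev (true :: enc_clause x) ++ l) rest) (pos 0 ra) (pos 0 rb)
      (pos 0 (if nth false ra (lit_index (tnth x ord0))
                 && nth false rb (lit_index (tnth x (inord 1)))
              then set_nth false rc (lit_index (tnth x (inord 2))) true else rc)) D O).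
Proof.
move=> hn hn2 ha hb hc.
have lt_lit := @lit_index_lt n.
have le_lit (y : literal n) : lit_index y <= S.
  by rewrite /lit_index; case: y => y [] /=; have := ltn_ord y; lia.
have lt_var (y : literal n) : y.1 <= S by apply: leq_trans hn; apply: ltnW.
set w := enc_clause x; move: (erefl w); rewrite {1}/w; clearbody w.
case: x => -[|y0 [|y1 [|y2 []]]] // hx; rewrite !(tnth_nth y0) /= !inordK //= => hw.
(* The left part of the input tape after one, two and three literals. *)
pose l1 := nseq y0.1 true ++ y0.2 :: true :: l.
pose l2 := nseq y1.1 true ++ y1.2 :: false :: l1.
pose l3 := nseq y2.1 true ++ y2.2 :: false :: l2.
have -> : rev (true :: w) ++ l = false :: l3.
  rewrite /l3 /l2 /l1 -hw /enc_clause /= cats0 !(rev_cons, rev_cat) /enc_unary !rev_rcons !rev_nseq.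
  by rewrite -?cats1 -?catA /=.
have -> : true :: w ++ rest = true :: y0.2 :: enc_unary y0.1 ++ y1.2 :: enc_unary y1.1 ++
    y2.2 :: enc_unary y2.1 ++ rest by rewrite -hw /enc_clause /= cats0 -!catA /= -!catA.
have hlit i s l' b0 (y : literal n) rest' r := @run_read_literal i s l' b0 y.2 y.1 rest' r.
exists (Store (tp l1 (false :: y1.2 :: enc_unary y1.1 ++ y2.2 :: enc_unary y2.1 ++ rest))
   (pos (lit_index y0) ra) (pos 0 rb) (pos 0 rc) D O).
  by apply: (@hlit TA _ l true y0 _ ra); rewrite ?ha ?lt_lit.
exists (Store (tp l2 (false :: y2.2 :: enc_unary y2.1 ++ rest))
   (pos (lit_index y0) ra) (pos (lit_index y1) rb) (pos 0 rc) D O).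
  by apply: (@hlit TB _ l1 false y1 _ rb); rewrite ?hb ?lt_lit.
exists (Store (tp l3 (false :: rest))
   (pos (lit_index y0) ra) (pos (lit_index y1) rb) (pos (lit_index y2) rc) D O).
  by apply: (@hlit TC _ l2 false y2 _ rc); rewrite ?hc ?lt_lit.
exists (Store (tp (false :: l3) rest)
   (pos (lit_index y0) ra) (pos (lit_index y1) rb) (pos (lit_index y2) rc) D O).
  exact: (@run_mvR S TI _ l3 false rest).
set b := _ && _; set rc' := if b then _ else _.
exists (Store (tp (false :: l3) rest)
   (pos (lit_index y0) ra) (pos (lit_index y1) rb) (pos (lit_index y2) rc') D O).
  rewrite !run_ifE /rd /= !read_pos ha hb !lt_lit /is_one /=.
  rewrite /rc' /b; case: nth; last exact: run_skip.
  case: nth; last exact: run_skip.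
  have := @run_mark S TC (Store (tp (false :: l3) rest)
   (pos (lit_index y0) ra) (pos (lit_index y1) rb) (pos (lit_index y2) rc) D O)
   (rev (take (lit_index y2) rc)) (drop (lit_index y2).+1 rc) true (nth false rc (lit_index y2)).
  rewrite -drop_nth ?hc // => /(_ erefl); congr (run _ _ _ (Store _ _ _ _ _ _)).
  rewrite /pos set_nthE hc lt_lit take_size_cat ?drop_size_cat //; rewrite size_take hc lt_lit //.
exists (Store (tp (false :: l3) rest)
   (pos 0 ra) (pos (lit_index y1) rb) (pos (lit_index y2) rc') D O).
  exact: (@run_rewind_pos S TA _ (lit_index y0)).
exists (Store (tp (false :: l3) rest) (pos 0 ra) (pos 0 rb) (pos (lit_index y2) rc') D O).
  exact: (@run_rewind_pos S TB _ (lit_index y1)).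
exact: (@run_rewind_pos S TC _ (lit_index y2)).
Qed.

(** One step of the invariant of [fill]: after some clauses have been read, [TC] holds the
    characteristic sequence of the third literals found so far. *)
Lemma mkseq_mem_clause n (cs : seq (clause3 n)) (x : clause3 n) a b m :
  lit_index (tnth x (inord 2)) < m ->
  (if (lit_index (tnth x ord0) == a) && (lit_index (tnth x (inord 1)) == b)
   then set_nth false (mkseq (mem_clause cs a b) m) (lit_index (tnth x (inord 2))) true
   else mkseq (mem_clause cs a b) m) = mkseq (mem_clause (rcons cs x) a b) m.
Proof.
case: x => -[|y0 [|y1 [|y2 []]]] // hx; rewrite !(tnth_nth y0) /= !inordK //= => hm.
have h c : mem_clause (rcons cs (Tuple hx)) a b c =
    [&& lit_index y0 == a, lit_index y1 == b & lit_index y2 == c] || mem_clause cs a b c.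
  by rewrite /mem_clause has_rcons /= !eqseq_cons andbT.
case: ifP => [/andP[h0 h1]|h0]; last first.
  by apply: eq_map => c; rewrite h andbA h0.
apply: (@eq_from_nth _ false).
  by rewrite size_set_nth !size_mkseq; apply/maxn_idPr.
move=> i; rewrite size_set_nth size_mkseq (maxn_idPr hm) => hi.
rewrite nth_set_nth /= !nth_mkseq // h h0 h1 /= eq_sym.
by case: (_ == i).
Qed.

Lemma run_fill n (cs : seq (clause3 n)) a b D O :
  let m := n.+1 * 2 in let body := enc_seq (@enc_clause n) cs in
  size (enc_unary n ++ body) <= S -> m <= S -> a < m -> b < m ->
  run S fill
    (Store (tp (rev (enc_unary n)) body) (pos 0 (onehot m a)) (pos 0 (onehot m b))
       (pos 0 (nseq m false)) D O)
    (Store (tp (rev (enc_unary n)) body) (pos 0 (onehot m a)) (pos 0 (onehot m b))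
       (pos 0 (mkseq (mem_clause cs a b) m)) D O).
Proof.
move=> m body hS hm ha hb.
have hn : n <= S by apply: leq_trans hm; rewrite /m; lia.
have hn2 : n * 2 <= S by apply: leq_trans hm; rewrite /m; lia.
pose bs := [seq true :: enc_clause x | x <- cs].
have hbody : body = flatten bs ++ [:: false] by rewrite /body /enc_seq cats1.
(* Every clause occupies at least its continuation bit in the code, which bounds the iterations. *)
have hcs : size cs <= S.
  apply: leq_trans hS; rewrite size_cat hbody size_cat size_flatten /shape -map_comp.
  apply: (@leq_trans (sumn [seq size (true :: enc_clause x) | x <- cs]));
    last by rewrite addnCA; apply: leq_addr.
  by elim: (cs) => //= x s; lia.
pose st j := Store (tp (rev (flatten (take j bs)) ++ rev (enc_unary n))
    (flatten (drop j bs) ++ [:: false]))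
  (pos 0 (onehot m a)) (pos 0 (onehot m b)) (pos 0 (mkseq (mem_clause (take j cs) a b) m)) D O.
exists (st (size cs)).
  exists (size cs), st; split=> //.
  - rewrite /st !take0 drop0 -hbody; congr (Store _ _ _ (pos 0 _) _ _).
    apply: (@eq_from_nth _ false); rewrite size_mkseq ?size_nseq // => i hi.
    by rewrite nth_mkseq // nth_nseq hi.
  - by rewrite /st /rd /= drop_oversize // size_map.
  move=> j hj.
  (* For [n = 0] there is no clause to serve as default value of [nth]; one is taken from [cs],
     nonempty since [j < size cs]. *)
  have [x hx] : exists x, nth x cs j = x /\ forall y, nth y cs j = x.
    by case: (cs) hj => // y s hj; exists (nth y (y :: s) j); split;
      [apply: set_nth_default | move=> z; apply: set_nth_default].
  have {hx} hx y : nth y cs j = x by case: hx.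
  have hd : drop j bs = (true :: enc_clause x) :: drop j.+1 bs.
    by rewrite (drop_nth [::]) ?size_map // (nth_map x) // hx.
  have ht : take j.+1 bs = rcons (take j bs) (true :: enc_clause x).
    by rewrite (take_nth [::]) ?size_map // (nth_map x) // hx.
  rewrite /st hd ht; split=> //.
  have := @run_read_clause n x (rev (flatten (take j bs)) ++ rev (enc_unary n))
    (flatten (drop j.+1 bs) ++ [:: false]) (onehot m a) (onehot m b)
    (mkseq (mem_clause (take j cs) a b) m) D O hn hn2.
  rewrite !onehotS // size_mkseq => h; have {h} := h erefl erefl erefl.
  rewrite !nth_onehot // mkseq_mem_clause; last first.
    exact: lit_index_lt.
  by rewrite (take_nth x hj) hx flatten_rcons rev_cat -catA /= -catA.
pose whole := enc_unary n ++ body.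
exists (set TI (tp [::] whole) (st (size cs))).
  rewrite /whole hbody.
  have -> : enc_unary n ++ flatten bs ++ [:: false]
    = rev (rev (flatten bs) ++ rev (enc_unary n)) ++ [:: false].
    by rewrite rev_cat !revK catA.
  apply: run_rewind.
    by rewrite /st /= take_oversize ?size_map // drop_oversize ?size_map.
  apply: leq_trans hS; rewrite hbody !size_cat !size_rev; lia.
exists (set TI (tp (nseq n true) (false :: body)) (st (size cs))).
  by apply: run_set; apply: (@run_seek _ TI _ true);
    rewrite // get_set /whole /enc_unary cat_rcons.
have := @run_mvR S TI (set TI (tp (nseq n true) (false :: body)) (st (size cs)))
  (nseq n true) false body erefl.
have -> : rev (enc_unary n) = false :: nseq n true by rewrite /enc_unary rev_rcons rev_nseq.
by rewrite /st take_size.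
Qed.

Lemma run_clear I A B r D O : size r <= S ->
  run S clear (Store I A B (pos 0 r) D O) (Store I A B (pos 0 (nseq (size r) false)) D O).
Proof.
move=> hr; pose st j := Store I A B (tp (nseq j false) (drop j r)) D O.
exists (st (size r)).
  exists (size r), st; split=> //; first by rewrite /st drop0 pos0.
    by rewrite /st /rd /= drop_size.
  move=> j hj; rewrite /st /rd /= (drop_nth false hj); split=> //.
  exact: (@run_put _ TC _ (nseq j false) (nth false r j :: drop j.+1 r) false).
have := @run_rewind S TC (st (size r)) (nseq (size r) false) [::].
by rewrite /st /= drop_size size_nseq rev_nseq cats0 pos0; apply.
Qed.

End Runs.

(** * Programs writing the network, and the words they emit *)

Definition write_rat (q : rat) : prog := emit (enc_rat q).

Definition write_row (i : tid) (p q : prog) : prog := each i (If i is_one p q).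

Definition write_negI : prog := for_hot TA (write_row TA (write_rat (-1)%R) (write_rat 0%R)).

Definition write_I : prog := for_hot TA (write_row TA (write_rat 1%R) (write_rat 0%R)).

Definition write_W1 : prog := for_hot TD
  (Seq (write_row TD (write_rat 1%R) (write_rat 0%R))
       (write_row TD (write_rat (-1)%R) (write_rat 0%R))).

Definition write_ones : prog := each TA (write_rat 1%R).

Definition write_true (i : tid) : prog := each i (emit [:: true]).

Definition write_layer2 : prog :=
  Seq (Seq (write_true TA) (emit [:: false])) (Seq write_negI write_ones).

Definition write_layer4 : prog :=
  Seq (Seq (Seq (Seq (write_true TA) (write_true TA)) (write_true TA)) (emit [:: false]))
  (Seq (Seq (Seq write_negI write_negI) write_I)
       (Seq (Seq write_ones write_ones) (each TA (write_rat 0%R)))).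

(** The number [beta] is fixed with the program and hard-coded; the remaining [m] digits come from a
    scan of [TC]. *)
Definition write_big (beta : nat) : prog :=
  Seq (emit [:: true]) (Seq
    (Seq (emit (rows beta (fun _ => [:: true; false]))) (each TC (emit [:: true; false])))
    (emit ([:: true; true; false] ++ enc_int 1))).

(** The formula is read anew for each pair of literals, so [TC] only ever holds the clauses of one
    pair. *)
Definition write_W5 (beta : nat) : prog := for_hot TA (for_hot TB
  (Seq fill (Seq
    (Seq (Seq (write_row TA (write_big beta) (write_rat 0%R))
              (write_row TB (write_big beta) (write_rat 0%R)))
         (write_row TC (write_rat (2%:R ^+ beta)%R) (write_rat 0%R)))
    clear))).

Definition write_zeros2 : prog := each TA (each TB (write_rat 0%R)).

Definition write_instance (beta : nat) : prog :=
  Seq (Seq (write_true TD) (emit [:: false])) (Seq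
  (Seq (Seq (Seq (Seq
    (Seq (Seq (write_true TA) (emit [:: false])) (Seq write_W1 write_ones))
    write_layer2) write_layer2) write_layer4)
    (Seq (Seq (each TA (write_true TB)) (emit [:: false])) (Seq (write_W5 beta) write_zeros2)))
  write_zeros2).

Lemma rows1 w : rows 1 w = w 0.
Proof. by rewrite /rows /mkseq /= cats0. Qed.

Lemma rows2 w : rows 2 w = w 0 ++ w 1.
Proof. by rewrite /rows /mkseq /= cats0. Qed.

Section Emits.

Variables (S beta n : nat) (cs : seq (clause3 n)).

Let m := n.+1 * 2.
Let body := enc_seq (@enc_clause n) cs.

Hypotheses (hS : size (enc_unary n ++ body) <= S) (hm : m <= S).

Let s0 : store := Store (tp (rev (enc_unary n)) body) (pos 0 (nseq m false))
  (pos 0 (nseq m false)) (pos 0 (nseq m false)) (pos 0 (nseq n.+1 false)) (tp [::] [::]).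

Let hN : n.+1 <= S.
Proof. by apply: leq_trans hm; rewrite /m leq_pmulr. Qed.

Lemma emits_eq p s w w' : emits S p s w -> w = w' -> emits S p s w'.
Proof. by move=> h <-. Qed.

(** Allows a program to emit from a temporarily modified store, as between [fill] and [clear]. *)
Lemma emits_frame p q r s s' w : (forall o, run S p (set TO o s) (set TO o s')) ->
  emits S q s' w -> (forall o, run S r (set TO o s') (set TO o s)) ->
  emits S (Seq p (Seq q r)) s w.
Proof.
move=> hp hq hr o; exists (set TO (tp o [::]) s'); first exact: hp.
by exists (set TO (tp (rev w ++ o) [::]) s').
Qed.

Lemma emits_each_const i p s r w : i <> TO -> get i s = pos 0 r -> size r <= S ->
  (forall j, emits S p (set i (pos j r) s) w) ->
  emits S (each i p) s (rows (size r) (fun _ => w)).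
Proof. by move=> hi hs hr hp; apply: emits_each. Qed.

Lemma emits_write_row_onehot i p q s k a w w' : i <> TO -> k <= S -> a < k ->
  get i s = pos 0 (onehot k a) ->
  (forall r, emits S p (set i r s) w) -> (forall r, emits S q (set i r s) w') ->
  emits S (write_row i p q) s (rows k (fun j => if j == a then w else w')).
Proof.
move=> hi hk ha hs hp hq.
apply: emits_eq (@emits_row S i p q s _ w w' hi hs _ _ _) _ => //; rewrite ?onehotS //.
by apply: eq_rows => j hj; rewrite nth_onehot.
Qed.

Lemma emits_write_true i s r : i <> TO -> get i s = pos 0 r -> size r <= S ->
  emits S (write_true i) s (rows (size r) (fun _ => [:: true])).
Proof. by move=> hi hs hr; apply: emits_each_const => // j; apply: emits_emit. Qed.

Lemma emits_unary i s r : i <> TO -> get i s = pos 0 r -> size r <= S ->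
  emits S (Seq (write_true i) (emit [:: false])) s (enc_unary (size r)).
Proof.
move=> hi hs hr; rewrite enc_unaryE; apply: emits_seq; last exact: emits_emit.
exact: emits_write_true.
Qed.

Lemma emits_write_negI :
  emits S write_negI s0 (rows m (fun i => rows m (fun j => enc_rat (W2 i j)))).
Proof.
apply: emits_for_hot => // a ha.
apply: emits_eq (emits_write_row_onehot _ hm ha _ _ _) _ => // [r|r|];
  try exact: emits_emit.
by apply: eq_rows => j _; rewrite /W2; case: eqP.
Qed.

Lemma emits_write_I :
  emits S write_I s0
    (rows m (fun i => rows m (fun j => enc_rat (if j == i then 1 else 0)%R))).
Proof.
apply: emits_for_hot => // a ha.
apply: emits_eq (emits_write_row_onehot _ hm ha _ _ _) _ => // [r|r|];
  try exact: emits_emit.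
by apply: eq_rows => j _; case: eqP.
Qed.

Lemma emits_write_W1 :
  emits S write_W1 s0 (rows m (fun i => rows n.+1 (fun j => enc_rat (W1 i j)))).
Proof.
rewrite /m rows_mul; apply: emits_for_hot => // a ha.
rewrite rows2; apply: emits_seq.
  apply: emits_eq (emits_write_row_onehot _ hN ha _ _ _) _ => // [r|r|];
    try exact: emits_emit.
  apply: eq_rows => j _; rewrite /W1 addn0 mulnK // oddM andbF.
  by case: eqP.
apply: emits_eq (emits_write_row_onehot _ hN ha _ _ _) _ => // [r|r|];
  try exact: emits_emit.
apply: eq_rows => j _; rewrite /W1 divnMDl // addn0 oddD oddM andbF /=.
by case: eqP.
Qed.

Lemma emits_const_A p s w : get TA s = pos 0 (nseq m false) ->
  (forall j, emits S p (set TA (pos j (nseq m false)) s) w) ->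
  emits S (each TA p) s (rows m (fun _ => w)).
Proof.
move=> hs hp; rewrite -[X in rows X](size_nseq m false).
by apply: emits_each_const; rewrite ?size_nseq.
Qed.

Lemma emits_const_B p s w : get TB s = pos 0 (nseq m false) ->
  (forall j, emits S p (set TB (pos j (nseq m false)) s) w) ->
  emits S (each TB p) s (rows m (fun _ => w)).
Proof.
move=> hs hp; rewrite -[X in rows X](size_nseq m false).
by apply: emits_each_const; rewrite ?size_nseq.
Qed.

Lemma emits_write_ones : emits S write_ones s0 (rows m (fun _ => enc_rat 1%R)).
Proof. by apply: emits_const_A => // j; apply: emits_emit. Qed.

Lemma emits_write_zeros2 : emits S write_zeros2 s0 (rows (m * m) (fun _ => enc_rat 0%R)).
Proof.
rewrite rows_mul; apply: emits_const_A => // j; apply: emits_const_B => // k.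
exact: emits_emit.
Qed.

Lemma emits_write_layer2 :
  emits S write_layer2 s0 (enc_unary m ++ enc_mx (mxn m m W2) ++ enc_mx (mxn m 1 one_col)).
Proof.
rewrite !enc_mxn; apply: emits_seq.
  by rewrite -[X in enc_unary X](size_nseq m false); apply: emits_unary; rewrite ?size_nseq.
apply: emits_seq; first exact: emits_write_negI.
apply: emits_eq emits_write_ones _.
by apply: eq_rows => i _; rewrite rows1.
Qed.

Lemma emits_write_layer4 :
  emits S write_layer4 s0 (enc_unary (m + m + m) ++
    enc_mx (mxn (m + m + m) m (W4 n)) ++ enc_mx (mxn (m + m + m) 1 (b4 n))).
Proof.
have mp : 0 < m by rewrite /m.
rewrite !enc_mxn; apply: emits_seq.
  rewrite enc_unaryE; apply: emits_seq; last exact: emits_emit.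
  rewrite !rows_add.
  have h : emits S (write_true TA) s0 (rows m (fun _ => [:: true])).
    by apply: emits_const_A => // j; apply: emits_emit.
  by do 2!apply: emits_seq => //.
rewrite !rows_add; apply: emits_seq; (apply: emits_seq; first apply: emits_seq).
- apply: emits_eq emits_write_negI _; apply: eq_rows => i hi; apply: eq_rows => j _.
  by rewrite /W4 -/m modn_small // ltn_addr.
- apply: emits_eq emits_write_negI _; apply: eq_rows => i hi; apply: eq_rows => j _.
  by rewrite /W4 -/m modnDl modn_small // ltn_add2l hi.
- apply: emits_eq emits_write_I _; apply: eq_rows => i hi; apply: eq_rows => j _.
  by rewrite /W4 -/m ltnNge leq_addr /= -addnA !modnDl modn_small.
- apply: emits_eq emits_write_ones _; apply: eq_rows => i hi.
  by rewrite rows1 /b4 -/m ltn_addr.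
- apply: emits_eq emits_write_ones _; apply: eq_rows => i hi.
  by rewrite rows1 /b4 -/m ltn_add2l hi.
- apply: emits_eq (emits_const_A (w := enc_rat 0%R) _ _) _ => //.
    by move=> j; apply: emits_emit.
  by apply: eq_rows => i hi; rewrite rows1 /b4 -/m ltnNge leq_addr.
Qed.

(** Only the length of the word on [TC] matters, so the marks left by [fill] do no harm. *)
Lemma emits_write_big s r : get TC s = pos 0 r -> size r = m ->
  emits S (write_big beta) s (enc_rat (- (2%:R ^+ (beta + m)))%R).
Proof.
move=> hs hr; rewrite enc_rat_negpow; apply: emits_seq; first exact: emits_emit.
apply: emits_seq; last exact: emits_emit.
rewrite rows_add; apply: emits_seq; first exact: emits_emit.
by rewrite -[X in rows X]hr; apply: emits_each_const; rewrite ?hr // => j; apply: emits_emit.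
Qed.

Lemma emits_write_W5 : emits S (write_W5 beta) s0
  (rows (m * m) (fun i => rows (m + m + m) (fun j => enc_rat (W5 beta cs i j)))).
Proof.
have mp : 0 < m by rewrite /m.
rewrite rows_mul; apply: emits_for_hot => // a ha; apply: emits_for_hot => // b hb.
set bm := mkseq (mem_clause cs a b) m.
pose s1 := Store (tp (rev (enc_unary n)) body) (pos 0 (onehot m a)) (pos 0 (onehot m b))
  (pos 0 bm) (pos 0 (nseq n.+1 false)) (tp [::] [::]).
have hbm : size bm = m by rewrite size_mkseq.
apply: (@emits_frame _ _ _ _ s1).
- by move=> o; apply: run_fill.
- rewrite !rows_add; apply: emits_seq; first apply: emits_seq.
  + apply: emits_eq (emits_write_row_onehot _ hm ha _ _ _) _ => // [r|r|].
    * exact: (@emits_write_big _ bm).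
    * exact: emits_emit.
    apply: eq_rows => j hj; rewrite /W5 -/m hj divnMDl // divn_small // addn0.
    by case: eqP.
  + apply: emits_eq (emits_write_row_onehot _ hm hb _ _ _) _ => // [r|r|].
    * exact: (@emits_write_big _ bm).
    * exact: emits_emit.
    apply: eq_rows => j hj.
    rewrite /W5 -/m ltnNge leq_addr /= ltn_add2l hj addKn modnMDl modn_small //.
    by case: eqP.
  + apply: emits_eq (@emits_row S TC _ _ s1 bm _ _ _ _ _ _ _) _ => //.
    * by rewrite hbm.
    * by move=> j; apply: emits_emit.
    * by move=> j; apply: emits_emit.
    rewrite hbm -[LHS]/(rows m _); apply: eq_rows => j hj.
    rewrite /W5 -/m ltnNge -addnA leq_addr /= ltn_add2l ltnNge leq_addr /= addnA addKn.
    by rewrite divnMDl // divn_small // addn0 modnMDl modn_small // /bm nth_mkseq //; case: ifP.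
- have hbS : size bm <= S by rewrite hbm.
  move=> o; have := run_clear (tp (rev (enc_unary n)) body) (pos 0 (onehot m a))
    (pos 0 (onehot m b)) (pos 0 (nseq n.+1 false)) o hbS.
  by rewrite hbm.
Qed.

Lemma emits_write_instance :
  emits S (write_instance beta) s0 (enc_inversion (sat_instance beta cs)).
Proof.
have hu : emits S (Seq (write_true TA) (emit [:: false])) s0 (enc_unary m).
  by rewrite -[X in enc_unary X](size_nseq m false); apply: emits_unary; rewrite ?size_nseq.
have hz : emits S write_zeros2 s0 (enc_mx (mxn (m * m) 1 zero_col)).
  rewrite enc_mxn; apply: emits_eq emits_write_zeros2 _.
  by apply: eq_rows => i _; rewrite rows1.
have -> : enc_inversion (sat_instance beta cs) = enc_unary n.+1 ++
    (((((enc_unary m ++ enc_mx (mxn m n.+1 W1) ++ enc_mx (mxn m 1 one_col))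
    ++ enc_unary m ++ enc_mx (mxn m m W2) ++ enc_mx (mxn m 1 one_col))
    ++ enc_unary m ++ enc_mx (mxn m m W2) ++ enc_mx (mxn m 1 one_col))
    ++ enc_unary (m + m + m) ++ enc_mx (mxn (m + m + m) m (W4 n))
       ++ enc_mx (mxn (m + m + m) 1 (b4 n)))
    ++ enc_unary (m * m) ++ enc_mx (mxn (m * m) (m + m + m) (W5 beta cs))
       ++ enc_mx (mxn (m * m) 1 zero_col))
    ++ enc_mx (mxn (m * m) 1 zero_col) by [].
apply: emits_seq.
  by rewrite -(size_nseq n.+1 false); apply: emits_unary; rewrite ?size_nseq.
apply: emits_seq => //; apply: emits_seq; first (apply: emits_seq; first (apply: emits_seq;
  first apply: emits_seq)).
- apply: emits_seq => //; apply: emits_seq.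
    rewrite enc_mxn; exact: emits_write_W1.
  rewrite enc_mxn; apply: emits_eq emits_write_ones _.
  by apply: eq_rows => i _; rewrite rows1.
- exact: emits_write_layer2.
- exact: emits_write_layer2.
- exact: emits_write_layer4.
- apply: emits_seq; last first.
    by apply: emits_seq => //; rewrite enc_mxn; apply: emits_write_W5.
  rewrite enc_unaryE; apply: emits_seq; last exact: emits_emit.
  rewrite rows_mul; apply: emits_const_A => // j; apply: emits_const_B => // k.
  exact: emits_emit.
Qed.

End Emits.

(** * Correctness of the network *)

Local Open Scope ring_scope.

Section Correctness.

Variable R : realType.

(** Reduces the gap to a single large coordinate, which is why one network serves all [p]. *)
Lemma lp_norm_ge (p m : nat) (v : 'cV[R]_m) i : (0 < p)%N -> `|v i 0| <= lp_norm p v.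
Proof.
move=> p0; rewrite /lp_norm.
have p0' : p%:R != 0 :> R by rewrite pnatr_eq0 -lt0n.
have {1}-> : `|v i 0| = (`|v i 0| ^+ p) `^ (p%:R^-1).
  by rewrite -powR_mulrn // -powRrM mulfV // powRr1.
apply: ge0_ler_powR.
- by rewrite invr_ge0.
- by rewrite nnegrE exprn_ge0.
- by rewrite nnegrE sumr_ge0 // => j _; rewrite exprn_ge0.
rewrite (bigD1 i) //= lerDl sumr_ge0 // => j _; exact: exprn_ge0.
Qed.

Lemma lp_norm0 (p m : nat) : (0 < p)%N -> lp_norm p (0 : 'cV[R]_m) = 0.
Proof.
move=> p0; rewrite /lp_norm big1; last by move=> i _; rewrite mxE normr0 expr0n gtn_eqF.
by rewrite powR0 // invr_eq0 pnatr_eq0 -lt0n.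
Qed.

Lemma relu_mxn m k (F b : nat -> nat -> rat) (f : nat -> R) :
  relu (map_mx ratr (mxn m k F) *m (\col_(j < k) f j) + map_mx ratr (mxn m 1 b))
  = \col_(i < m) Num.max (\sum_(j < k) ratr (F i j) * f j + ratr (b i 0%N)) 0.
Proof.
apply/colP => i; rewrite !mxE; congr (Num.max (_ + _) _).
by apply: eq_bigr => j _; rewrite !mxE.
Qed.

Lemma sum_single k (a : nat) (c : rat) (f : nat -> R) : (a < k)%N ->
  \sum_(j < k) ratr (if j == a :> nat then c else 0) * f j = ratr c * f a.
Proof.
move=> ha; rewrite (bigD1 (Ordinal ha)) //= eqxx big1 ?addr0 // => j.
by rewrite -val_eqE /= => /negbTE ->; rewrite raddf0 mul0r.
Qed.

Variables (beta n : nat) (cs : seq (clause3 n)).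

Let N := n.+1.
Let m := (N * 2)%N.

Section Eval.

Variable z : nat -> R.

(** It is nonnegative when the assignment [0 <= z] falsifies the literal. At [z = 0] a positive
    literal is true although its truth value is 0; only the implication from falsity to value 0 is
    needed. *)
Definition literal_sign (i : nat) : R := (if odd i then -1 else 1) * z (i %/ 2)%N.

Definition literal_truth (i : nat) : R :=
  Num.max (1 - Num.max (literal_sign i + 1) 0) 0.

Definition unit_input (a b : nat) : R :=
  - 2%:R ^+ (beta + m) * (literal_truth a + literal_truth b)
  + \sum_(c < m) (if mem_clause cs a b c then 2%:R ^+ beta else 0) * (1 - literal_truth c).

Lemma literal_truth_ge0 i : 0 <= literal_truth i.
Proof. by rewrite le_max lexx orbT. Qed.

Lemma literal_truth_le1 i : literal_truth i <= 1.
Proof. by rewrite ge_max ler01 andbT lerBlDr lerDl le_max lexx orbT. Qed.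

Lemma literal_truth_eq0 i : 0 <= literal_sign i -> literal_truth i = 0.
Proof.
move=> h; rewrite /literal_truth [Num.max (literal_sign i + 1) 0]max_l; last by lra.
by apply/max_idPr; lra.
Qed.

Lemma literal_truth_eq1 i : literal_sign i <= -1 -> literal_truth i = 1.
Proof.
move=> h; rewrite /literal_truth [Num.max (literal_sign i + 1) 0]max_r; last by lra.
by rewrite subr0; apply/max_idPl; lra.
Qed.

Lemma sat_net_eval :
  net_eval (net_map ratr (sat_net beta cs)) (\col_(j < N) z j)
  = \col_(i < m * m) Num.max (unit_input (i %/ m) (i %% m)) 0.
Proof.
have mp : (0 < m)%N by rewrite /m.
rewrite /= relu_mxn.
pose g := literal_truth.
have g0 i : 0 <= g i by exact: literal_truth_ge0.
have g1 i : g i <= 1 by exact: literal_truth_le1.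
have r1 : ratr 1 = 1 :> R by rewrite rmorph1.
have r0 : ratr 0 = 0 :> R by rewrite raddf0.
have -> : \col_(i < m) Num.max (\sum_(j < N) ratr (W1 i j) * z j + ratr (one_col i 0%N)) 0
    = \col_(i < m) Num.max (literal_sign i + 1) 0.
  apply/colP => i; rewrite !mxE r1 sum_single; last by rewrite ltn_divLR.
  by rewrite /literal_sign; case: (odd i); rewrite ?raddfN /= r1.
have eqW2 (f : nat -> R) : relu (map_mx ratr (mxn m m W2) *m (\col_(j < m) f j)
     + map_mx ratr (mxn m 1 one_col)) = \col_(i < m) Num.max (1 - f i) 0.
  rewrite relu_mxn; apply/colP => i; rewrite !mxE r1 sum_single //.
  by rewrite raddfN /= r1 mulN1r addrC.
rewrite (eqW2 (fun i => Num.max (literal_sign i + 1) 0)).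
rewrite (eqW2 (fun i => Num.max (1 - Num.max (literal_sign i + 1) 0) 0)).
(* The third layer is affine on its actual inputs, as [g] is at most 1. *)
have -> : \col_(i < m) Num.max (1 - Num.max (1 - Num.max (literal_sign i + 1) 0) 0) 0
   = \col_(i < m) (1 - g i).
  by apply/colP => i; rewrite !mxE; apply/max_idPl; rewrite subr_ge0; apply: g1.
rewrite (relu_mxn _ _ _ _ (fun i => 1 - g i)).
have -> : \col_(i < m + m + m)
      Num.max (\sum_(j < m) ratr (W4 n i j) * (1 - g j) + ratr (b4 n i 0%N)) 0
   = \col_(i < m + m + m) (if (i < m + m)%N then g (i %% m)%N else 1 - g (i %% m)%N).
  apply/colP => i; rewrite !mxE /W4 /b4 -/m; case: ifP => _.
    rewrite (sum_single _ (fun j => 1 - g j)) ?ltn_pmod // raddfN /= r1 mulN1r opprB subrK.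
    by apply/max_idPl; apply: g0.
  rewrite (sum_single _ (fun j => 1 - g j)) ?ltn_pmod // r1 r0 mul1r addr0.
  by apply/max_idPl; rewrite subr_ge0; apply: g1.
pose h i := if (i < m + m)%N then g (i %% m)%N else 1 - g (i %% m)%N.
rewrite (relu_mxn _ _ _ _ h); apply/colP => i; rewrite !mxE r0 addr0; congr Num.max.
have hm : (i %/ m < m)%N by rewrite ltn_divLR.
have hm' : (i %% m < m)%N by rewrite ltn_pmod.
have big_ratr : ratr (- 2%:R ^+ (beta + m)) = - 2%:R ^+ (beta + m) :> R.
  by rewrite rmorphN rmorphXn /= ratr_nat.
(* The columns split into the three blocks of the fourth layer; in the first two, the sum has one
   nonzero weight. *)
rewrite !big_split_ord /= /unit_input mulrDr; congr (_ + _ + _).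
- rewrite -big_ratr -(sum_single _ g hm); apply: eq_bigr => j _.
  by rewrite /W5 /h -/m ltn_ord ltn_addr // (modn_small (ltn_ord j)).
- rewrite -big_ratr -(sum_single _ g hm'); apply: eq_bigr => j _.
  rewrite /W5 /h -/m ltnNge leq_addr /= ltn_add2l ltn_ord addKn.
  by rewrite modnDl (modn_small (ltn_ord j)).
- apply: eq_bigr => j _.
  rewrite /W5 /h -/m ltnNge -addnA leq_addr /= ltn_add2l ltnNge leq_addr /= addnA addKn.
  rewrite -addnA !modnDl (modn_small (ltn_ord j)); congr (_ * _).
  by case: ifP => _; rewrite ?r0 // rmorphXn /= ratr_nat.
Qed.

(** The unit is that of the first two literals: its large negative term vanishes, the third literal
    contributes the full [2 ^ beta], and the other summands are nonnegative. *)
Lemma unit_input_ge (x : clause3 n) : x \in cs ->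
  (forall l, l \in (x : seq (literal n)) -> literal_truth (lit_index l) = 0) ->
  exists i : 'I_(m * m), 2%:R ^+ beta <= unit_input (i %/ m) (i %% m).
Proof.
have mp : (0 < m)%N by rewrite /m.
case: x => -[|y0 [|y1 [|y2 []]]] // hx x_cs h.
have h0 : literal_truth (lit_index y0) = 0 by apply: h; rewrite !inE eqxx.
have h1 : literal_truth (lit_index y1) = 0 by apply: h; rewrite !inE eqxx orbT.
have h2 : literal_truth (lit_index y2) = 0 by apply: h; rewrite !inE eqxx !orbT.
have lt0 := lit_index_lt y0; have lt1 := lit_index_lt y1; have lt2 := lit_index_lt y2.
have hi : (lit_index y0 * m + lit_index y1 < m * m)%N.
  by apply: (@leq_trans (lit_index y0 * m + m)); rewrite ?ltn_add2l // -mulSnr leq_mul2r lt0 orbT.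
exists (Ordinal hi); rewrite /= divnMDl // divn_small // addn0 modnMDl modn_small //.
rewrite /unit_input h0 h1 addr0 mulr0 add0r (bigD1 (Ordinal lt2)) //=.
have -> : mem_clause cs (lit_index y0) (lit_index y1) (lit_index y2).
  by apply/hasP; exists (Tuple hx).
rewrite h2 subr0 mulr1 lerDl sumr_ge0 // => c _.
by rewrite mulr_ge0 ?subr_ge0 ?literal_truth_le1 //; case: ifP => // _; apply: exprn_ge0.
Qed.

(** If [a] or [b] has truth value 1, the negative term outweighs the sum, which is at most
    [m * 2 ^ beta]. Otherwise every clause counted by this unit has its true literal in third
    position, so each summand is 0. *)
Lemma unit_input_le0 a b :
  (forall x, x \in cs -> exists2 l, l \in (x : seq (literal n)) &
     literal_truth (lit_index l) = 1) ->
  unit_input a b <= 0.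
Proof.
move=> hcs; rewrite /unit_input.
have hsum : \sum_(c < m) (if mem_clause cs a b c then 2%:R ^+ beta else 0) * (1 - literal_truth c)
    <= 2%:R ^+ (beta + m).
  apply: (@le_trans _ _ (\sum_(c < m) 2%:R ^+ beta)).
    apply: ler_sum => c _; rewrite -[leRHS]mulr1; apply: ler_pM.
    - by case: ifP => // _; apply: exprn_ge0.
    - by rewrite subr_ge0 literal_truth_le1.
    - by case: ifP => // _; apply: exprn_ge0.
    - by rewrite gerDl oppr_le0 literal_truth_ge0.
  rewrite sumr_const card_ord -[leLHS]mulr_natr exprD ler_pM2l ?exprn_gt0 //.
  by rewrite -natrX ler_nat ltnW // ltn_expl.
have big_ge0 : 0 <= 2%:R ^+ (beta + m) :> R by rewrite exprn_ge0.
have ga := literal_truth_ge0 a; have gb := literal_truth_ge0 b.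
have [ha|ha] := eqVneq (literal_truth a) 1; first by rewrite ha; nra.
have [hb|hb] := eqVneq (literal_truth b) 1; first by rewrite hb; nra.
rewrite big1 ?addr0; first by rewrite mulNr oppr_le0 mulr_ge0 ?addr_ge0.
move=> c _; case: ifP => [/hasP[x x_cs /eqP hx]|]; last by rewrite mul0r.
have [l l_x hl] := hcs x x_cs.
have : lit_index l \in [:: a; b; nat_of_ord c] by rewrite -hx map_f.
rewrite !inE => /or3P[] /eqP e; rewrite e in hl.
- by rewrite hl eqxx in ha.
- by rewrite hl eqxx in hb.
- by rewrite hl subrr mulr0.
Qed.

End Eval.

Lemma literal_sign_lit z (l : literal n) :
  literal_sign z (lit_index l) = (if l.2 then -1 else 1) * z l.1.
Proof.
case: l => i b; rewrite /literal_sign /lit_index /= oddD oddM andbF /= oddb.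
by rewrite divnMDl // divn_small ?addn0 //; case: b.
Qed.

Lemma sat_instance_correct (p : nat) (delta : R) : (0 < p)%N -> 0 < delta ->
  delta < 2%:R ^+ beta ->
  approx_invertible p delta (sat_instance beta cs) <-> satisfiable (Cnf3 cs).
Proof.
move=> p0 d0 hd.
have obs0 : map_mx ratr (observation (sat_instance beta cs)) = 0 :> 'cV[R]_(m * m).
  by apply/colP => i; rewrite !mxE raddf0.
split=> [[z hz]|[A hA]].
  pose zf j := z (inord j) 0.
  have ez : z = \col_(j < N) zf j by apply/colP => j; rewrite mxE /zf inord_val.
  (* Rounding by sign: all literals of a clause falsified by this assignment have truth value 0, so
     some output is at least [2 ^ beta > delta]. *)
  exists (fun v : 'I_n => 0 <= zf v); apply/allP => x x_cs; apply: contraT => hx.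
  have [l l_x|i hi] := @unit_input_ge zf x x_cs.
    apply: literal_truth_eq0; rewrite literal_sign_lit.
    have := hx; rewrite -all_predC => /allP/(_ l l_x) /=.
    by case: (l.2); case: (lerP 0 (zf l.1)) => // h _; lra.
  have := lp_norm_ge (net_eval (net_map ratr (net (sat_instance beta cs))) z -
    map_mx ratr (observation (sat_instance beta cs))) i p0.
  move=> /le_trans/(_ hz); rewrite obs0 subr0 ez sat_net_eval mxE => hle.
  have : 2%:R ^+ beta <= delta.
    apply: le_trans hle; apply: le_trans (ler_norm _).
    by rewrite le_max hi.
  by rewrite leNgt hd.
(* Values 1 and -1 make all truth values exactly 0 or 1; the outer default -1 fills the spare
   coordinate. *)
pose zf j : R := if insub j is Some v then (if A v then 1 else -1) else -1.
exists (\col_(j < N) zf j); rewrite obs0 subr0 sat_net_eval.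
have -> : \col_(i < m * m) Num.max (unit_input zf (i %/ m) (i %% m)) 0 = 0.
  apply/colP => i; rewrite !mxE; apply/max_idPr; apply: unit_input_le0 => x x_cs.
  have /hasP[l l_x /eqP hl] := allP hA x x_cs.
  exists l => //; apply: literal_truth_eq1; rewrite literal_sign_lit /zf valK hl.
  by case: (l.2); rewrite ?mul1r ?mulr1.
by rewrite lp_norm0 // ltW.
Qed.

End Correctness.

Local Open Scope nat_scope.

(** * Running time *)

Definition poly_bounded (f : nat -> nat) : Prop :=
  exists K k, forall x, f x <= K * x.+1 ^ k.

Lemma poly_boundedC c : poly_bounded (fun _ => c).
Proof. by exists c, 0 => x; rewrite muln1. Qed.

Lemma poly_bounded_id : poly_bounded id.
Proof. by exists 1, 1 => x; rewrite mul1n expn1. Qed.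

Lemma poly_boundedD f g :
  poly_bounded f -> poly_bounded g -> poly_bounded (fun x => f x + g x).
Proof.
move=> [K [k hf]] [L [l hg]]; exists (K + L), (k + l) => x; rewrite mulnDl leq_add //.
- by apply: leq_trans (hf x) _; rewrite leq_mul2l leq_pexp2l ?leq_addr ?orbT.
- by apply: leq_trans (hg x) _; rewrite leq_mul2l leq_pexp2l ?leq_addl ?orbT.
Qed.

Lemma poly_boundedM f g :
  poly_bounded f -> poly_bounded g -> poly_bounded (fun x => f x * g x).
Proof.
move=> [K [k hf]] [L [l hg]]; exists (K * L), (k + l) => x.
by rewrite expnD mulnACA leq_mul.
Qed.

Lemma poly_boundedX f k : poly_bounded f -> poly_bounded (fun x => f x ^ k).
Proof.
move=> hf; elim: k => [|k IHk]; first exact: (poly_boundedC 1).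
have [K [l h]] := poly_boundedM hf IHk.
by exists K, l => x; rewrite expnS.
Qed.

Lemma poly_bounded_cost p f : poly_bounded f -> poly_bounded (fun x => cost (f x) p).
Proof.
move=> hf; have [K [k hp]] := cost_poly p.
have [L [l h]] := poly_boundedM (poly_boundedC K)
  (poly_boundedX k (poly_boundedD (poly_boundedC 1) hf)).
by exists L, l => x; apply: leq_trans (hp _) (h x).
Qed.

(** The writing loops are bounded in terms of the formula, but rewinding the output needs a larger
    bound. *)
Lemma run_mono S S' p s s' : S <= S' -> run S p s s' -> run S' p s s'.
Proof.
move=> hS; elim: p s s' => [//|p IHp q IHq|i f p IHp q IHq|i f p IHp] s s'.
- by case=> u /IHp hp /IHq hq; exists u.
- by rewrite !run_ifE; case: (f _) => [/IHp|/IHq].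
- case=> k [st [hk e0 ek hf h]]; exists k, st; split=> //; first exact: leq_trans hS.
  by move=> j /h[hfj /IHp].
Qed.

Lemma cells_eq_size u (v : seq bool) : cells_eq u (map Some v) -> size v <= size u.
Proof.
move=> h; rewrite leqNgt; apply/negP => hlt; have := h (size u).
by rewrite nth_default // (nth_map false).
Qed.

(** * The composite machine and its running time *)

Definition start_store (w : seq bool) : store :=
  let z := tp [::] [::] in Store (tp [::] w) z z z z z.

Lemma init_agree M p w : @agree M (init_config (combine M p) w).2 (start_store w).
Proof.
move=> j; rewrite tnth_mktuple -val_eqE /=.
by case: (nat_of_ord j) => [|[|[|[|[|[|k]]]]]].
Qed.

(** A step lists at most two new cells per tape, so the running time bounds the length of the
    output; the code of the network need not be measured directly. *)
Lemma output_size (M : machine) S p w s w' : run S p (start_store w) s ->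
  tO s = tp (rev w') [::] -> size w' <= (cost S p).*2.
Proof.
move=> hr hO.
have [t [T [ht hT e]]] := @combine_run_prog M p S _ _ hr _ (@init_agree M p w).
have := hT (tord M TO); rewrite tordE /= hO => -[/cells_eq_size hsz _].
rewrite size_rev in hsz; apply: leq_trans hsz _.
have := @iter_step_size (combine M p) t (init_config (combine M p) w) (tord M TO).
rewrite /init_config /= e /= tnth_mktuple -val_eqE /= tordE /= /tape_size /= => h.
apply: leq_trans (leq_addr _ _) (leq_trans h _).
by rewrite leq_double.
Qed.

Lemma answer_combine (M : machine) S p w w' s t b :
  run S p (start_store w) s -> tO s = tp [::] w' -> answer M t w' = Some b ->
  exists2 t', t' <= cost S p + t & answer (combine M p) t' w = Some b.
Proof.
move=> hr hO hM.
have [t0 [T [ht hT e]]] := @combine_run_prog M p S _ _ hr _ (@init_agree M p w).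
exists (t + t0); first by rewrite addnC leq_add2r.
rewrite /answer iterD e.
rewrite (@combine_run_machine M p t (start M) T (init_config M w').2) //.
move=> j; rewrite tnth_mktuple; have := hT (rshift 5 j).
rewrite -val_eqE /=; case: (nat_of_ord j) => [|k] /=; last by [].
by rewrite hO.
Qed.

Definition write_code (beta : nat) : prog := Seq prepare (write_instance beta).

Definition reduction (beta : nat) : prog := Seq (write_code beta) (rewind TO).

(** The factor 2 provides for the work tapes of length [2 (n + 1)], since the code of the formula
    has at least [n + 1] bits. *)
Lemma run_write_code S beta phi : size (enc_cnf3 phi) * 2 <= S ->
  exists2 s, run S (write_code beta) (start_store (enc_cnf3 phi)) s
    & tO s = tp (rev (enc_inversion (sat_instance beta (clauses phi)))) [::].
Proof.
case: phi => n cs; rewrite /enc_cnf3 /= => hS.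
have hu : size (enc_unary n) = n.+1 by rewrite size_rcons size_nseq.
have hn : n.+1 * 2 <= S by apply: leq_trans hS; rewrite size_cat hu leq_mul2r leq_addr orbT.
have hw : size (enc_unary n ++ enc_seq (@enc_clause n) cs) <= S.
  by apply: leq_trans hS; rewrite leq_pmulr.
have h := @emits_write_instance S beta n cs hw hn [::].
eexists.
  exists (Store (tp (rev (enc_unary n)) (enc_seq (@enc_clause n) cs))
       (pos 0 (nseq (n.+1 * 2) false))
       (pos 0 (nseq (n.+1 * 2) false)) (pos 0 (nseq (n.+1 * 2) false))
       (pos 0 (nseq n.+1 false)) (tp [::] [::])); last exact: h.
  exact: run_prepare.
by rewrite /= cats0.
Qed.

Lemma run_reduction (M : machine) S beta phi : size (enc_cnf3 phi) * 2 <= S ->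
  let w := enc_inversion (sat_instance beta (clauses phi)) in
  let c := (cost S (write_code beta)).*2 in
  size w <= c /\
  exists2 s, run (S + c) (reduction beta) (start_store (enc_cnf3 phi)) s & tO s = tp [::] w.
Proof.
move=> hS w c; have [s hs hO] := run_write_code beta hS.
have hw : size w <= c by apply: (output_size M hs hO).
split=> //; exists (set TO (tp [::] w) s); last by case: (s).
exists s; first exact: run_mono (leq_addr _ _) hs.
have := @run_rewind (S + c) TO s _ _ hO; rewrite revK cats0 size_rev; apply.
exact: leq_trans hw (leq_addl _ _).
Qed.

Local Open Scope ring_scope.

Lemma pow2_gt (R : realType) (x : R) : exists k : nat, x < 2%:R ^+ k.
Proof.
exists (Num.bound `|x|); apply: (@lt_le_trans _ _ (Num.bound `|x|)%:R).
  by apply: le_lt_trans (ler_norm x) _; apply: archi_boundP.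
by rewrite -natrX ler_nat ltnW // ltn_expl.
Qed.

Lemma solvable_three_sat (R : realType) (p : nat) (delta c : R) :
  (0 < p)%N -> 0 < delta -> 0 < c ->
  solvable_in_exp_time (approx_inversion 5 6 p delta) c ->
  solvable_in_exp_time three_sat c.
Proof.
move=> p0 d0 c0 [M [K [k hM]]].
have [beta hbeta] := pow2_gt delta.
(* The latent dimension [n + 1] in place of [n] costs a factor [2 ^ c], which [2 ^ D] bounds by an
   integer. *)
have [D hD] := pow2_gt (2 `^ c).
pose len x := (cost (x * 2) (write_code beta)).*2.
(* The time of the reduction plus the non-exponential factor of the time of [M]; [len x] bounds the
   length of the code handed to [M]. *)
pose T x := (cost (x * 2 + len x) (reduction beta) + K * (len x).+1 ^ k * 2 ^ D)%N.
have poly_len : poly_bounded len.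
  have [L [l h]] := poly_boundedM (poly_boundedC 2) (poly_bounded_cost (write_code beta)
    (poly_boundedM poly_bounded_id (poly_boundedC 2))).
  by exists L, l => x; rewrite /len -mul2n; apply: h.
have [L [l hT]] : poly_bounded T.
  apply: poly_boundedD.
    apply: poly_bounded_cost; apply: poly_boundedD => //.
    exact: poly_boundedM poly_bounded_id (poly_boundedC 2).
  apply: poly_boundedM (poly_boundedC _); apply: poly_boundedM (poly_boundedC _) _.
  apply: (@poly_boundedX (fun x => (len x).+1)).
  have [L [l h]] := poly_boundedD (poly_boundedC 1) poly_len.
  by exists L, l.
exists (combine M (reduction beta)), L, l => phi.
set x := size (enc_cnf3 phi).
have [hlen [s hs hO]] := run_reduction M beta (leqnn (x * 2)).
have [t [b [hb hyes ht]]] := hM (sat_instance beta (clauses phi)).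
have [t' ht' hb'] := answer_combine hs hO hb.
exists t', b; split=> //.
  rewrite hyes; apply: iff_trans (sat_instance_correct (clauses phi) p0 d0 hbeta) _.
  by case: (phi).
(* Lets the time of the reduction, which has no exponential factor, be absorbed into the bound. *)
have h1 : 1 <= 2 `^ (c * (nvars phi)%:R).
  by rewrite -[leLHS](powRr0 2); apply: ler_powR; rewrite ?ler1n // mulr_ge0 // ltW.
apply: (@le_trans _ _ ((T x)%:R * 2 `^ (c * (nvars phi)%:R))); last first.
  rewrite ler_wpM2r ?powR_ge0 // -natrX -natrM ler_nat; exact: hT.
apply: (@le_trans _ _ (cost (x * 2 + len x) (reduction beta) + t)%:R).
  by rewrite ler_nat.
rewrite /T; move: (cost (x * 2 + len x) (reduction beta)) => A.
rewrite !natrD mulrDl; apply: lerD; first by rewrite ler_peMr.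
apply: le_trans ht _.
have -> : param (p := approx_inversion 5 6 p delta) (sat_instance beta (clauses phi))
  = (nvars phi).+1 by [].
rewrite -[(nvars phi).+1%:R]natr1 mulrDr mulr1 powRD; last by rewrite pnatr_eq0 implybT.
rewrite [2 `^ _ * _]mulrC !mulrA ler_wpM2r ?powR_ge0 // !natrM !natrX.
apply: ler_pM; rewrite ?powR_ge0 ?mulr_ge0 ?exprn_ge0 //; last exact: ltW.
rewrite ler_wpM2l // lerXn2r ?nnegrE // ler_nat.
exact: hlen.
Qed.

(** The rate [c] given by [ETH] carries over unchanged: the dimension grows only by one. *)
Theorem theorem6 (R : realType) :
  ETH R ->
  exists C : nat, forall (p : nat) (delta : R),
    (0 < p)%N -> ~~ odd p -> 0 < delta ->
    exp_hard R (approx_inversion 5 C p delta).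
Proof.
move=> [c c0 hard]; exists 6%N => p delta p0 _ d0; exists c => // h.
exact: hard (solvable_three_sat p0 d0 c0 h).
Qed.
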